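(* Let $\zeta\in\mathbb{C}\setminus\{0\}$ with $\arg\zeta\in(0,90^\circ]$ and consider the potential $V(u)=-\frac1{4u^2}+\zeta^2$ for $u>0$. On the interval $$0< u\le\frac1{2|\zeta|}$$ the $T$-method (described in the context) applies with $g\equiv0$ and $$\tilde V=-\frac1{4u^2},\qquad\tilde\phi(u)=\sqrt u\,\log|\zeta u|-i\sqrt u ;$$ that is, $U<0$ on this interval, the function $T$ given by $\log T(u)=\int_0^uE$ is well-defined, and the circle with center $\alpha+i\beta$ and radius $R$ is invariant under the Riccati flow $y'=V-y^2$ on this interval. Moreover, the function $T$ is bounded uniformly in $\zeta$. If in addition $\operatorname{Im}\zeta^2>0$, then there is a constant $C$ which depends only on $\arg\zeta$ such that the Riccati solution $y=\phi'/\phi$ corresponding to the Sturm-Liouville solution $\phi$ specified in the context satisfies $$|\operatorname{Re}y|\le C|\zeta|\qquad\text{and}\qquad\operatorname{Im}y\ge\frac{|\zeta|}{C}\qquad\text{for all }u>\frac1{2|\zeta|}.$$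
   Context: The solution $\phi$ of $(-\frac{d^2}{du^2}+V)\phi=0$ is $$\phi(u)=-\sqrt u\Big(K_0(\zeta u)+\big(i\arg\zeta-\log2+\gamma+i\big)I_0(\zeta u)\Big),$$ with $K_0,I_0$ modified Bessel functions, $\gamma$ Euler's constant and $\arg\zeta$ in radians; near the origin it behaves like $\phi(u)=\sqrt u\log|\zeta u|-i\sqrt u+\mathscr{O}(u)$. $T$-method: let $\tilde y=\tilde\phi'/\tilde\phi=\alpha+i\tilde\beta$ ($\alpha,\tilde\beta$ real), $U=\operatorname{Re}V-\alpha^2-\alpha'=\operatorname{Re}(V-\tilde V)-\tilde\beta^2$, and (for $g\equiv0$) $E=|E_1+E_2+E_3|$ with $$E_1=\frac{1}{2|U|}\big(4\alpha\operatorname{Re}(V-\tilde V)+\operatorname{Re}(V-\tilde V)'\big),\quad E_2=\frac{\tilde\beta}{|U|}\operatorname{Im}(V-\tilde V),\quad E_3=-\frac{\operatorname{Im}V}{|U|}\frac{\operatorname{Re}(V-\tilde V)}{\sqrt{|U|}+\tilde\beta}.$$ Then $\beta=\frac{\sqrt{|U|}}2(T+\frac1T)$, $R=\frac{\sqrt{|U|}}2(T-\frac1T)$. The circles with center $m(u)$ and radius $R(u)$ are invariant under the Riccati flow on an interval if for every solution $y$ of $y'=V-y^2$ and all $v_0<v_1$ in it, $|y(v_0)-m(v_0)|\le R(v_0)$ implies $|y(v_1)-m(v_1)|\le R(v_1)$. *)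

(* Defs.v *)
From Stdlib Require Import Reals Factorial.
From Coquelicot Require Import Coquelicot.
Open Scope R_scope.

(** ** Complex-valued functions of a real variable *)

Definition CDerive (f : R -> C) (u : R) : C :=
  (Derive (fun x => Re (f x)) u, Derive (fun x => Im (f x)) u).

Definition is_CDerive (f : R -> C) (u : R) (l : C) : Prop :=
  @is_derive R_AbsRing C_R_NormedModule f u l.

Definition CSeries (a : nat -> C) : C :=
  (Series (fun n => Re (a n)), Series (fun n => Im (a n))).

(** Principal argument and logarithm: for [z <> 0], [Carg z] is in (-PI, PI]. *)
Definition Carg (z : C) : R :=
  if Rle_dec 0 (Im z) then acos (Re z / Cmod z) else - acos (Re z / Cmod z).

Definition Clog (z : C) : C := (ln (Cmod z), Carg z).

(** ** Modified Bessel functions of order zero *)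

Definition harmonic (n : nat) : R := sum_n_m (fun j => / INR j) 1 n.

Definition euler_gamma : R :=
  real (Lim_seq (fun n => harmonic n - ln (INR n))).

Definition Bessel_I0 (z : C) : C :=
  CSeries (fun k => ((z ^ 2 / 4) ^ k / (INR (fact k) ^ 2)%R)%C).

(** Standard expansion of the principal branch of [K_0] (DLMF 10.31.2);
    the term [k = 0] vanishes because [harmonic 0 = 0]. *)
Definition Bessel_K0 (z : C) : C :=
  (- (Clog (z / 2) + euler_gamma) * Bessel_I0 z
   + CSeries (fun k =>
       harmonic k * ((z ^ 2 / 4) ^ k / (INR (fact k) ^ 2)%R)))%C.

(** ** Sturm-Liouville and Riccati equations *)

(** [phi'' = V phi] on the set [J]. *)
Definition SL_solution (V : R -> C) (J : R -> Prop) (phi : R -> C) : Prop :=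
  forall u, J u ->
    is_CDerive phi u (CDerive phi u) /\
    is_CDerive (CDerive phi) u (V u * phi u)%C.

Definition log_deriv (phi : R -> C) (u : R) : C := (CDerive phi u / phi u)%C.

(** [y' = V - y^2] on [[v0, v1]]: for [V] continuous there, continuity up to the
    endpoints together with the equation inside is the same as the equation on
    the closed interval with one-sided derivatives at the endpoints. *)
Definition Riccati_solution (V : R -> C) (v0 v1 : R) (y : R -> C) : Prop :=
  @continuous_on R_UniformSpace C_UniformSpace (fun u => v0 <= u <= v1) y /\
  forall u, v0 < u < v1 -> is_CDerive y u (V u - y u ^ 2)%C.

(** Solutions may blow up elsewhere, so [y] need only solve the equation on
    [[v0, v1]]. *)
Definition circles_invariant
    (V : R -> C) (J : R -> Prop) (m : R -> C) (r : R -> R) : Prop :=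
  forall (y : R -> C) (v0 v1 : R),
    J v0 -> J v1 -> v0 < v1 -> Riccati_solution V v0 v1 y ->
    Cmod (y v0 - m v0)%C <= r v0 -> Cmod (y v1 - m v1)%C <= r v1.

(** ** The T-method with g = 0 *)

Section TMethod.

Variables (V Vt phit : R -> C).

Definition alpha (u : R) : R := Re (log_deriv phit u).
Definition betat (u : R) : R := Im (log_deriv phit u).

(** If [phit'' = Vt phit] and [phit <> 0], the Riccati equation for
    [log_deriv phit] gives [U u = Re (V u - Vt u) - betat u ^ 2]. *)
Definition U (u : R) : R := Re (V u) - alpha u ^ 2 - Derive alpha u.

Definition E1 (u : R) : R :=
  1 / (2 * Rabs (U u)) *
  (4 * alpha u * Re (V u - Vt u)%C + Derive (fun x => Re (V x - Vt x)%C) u).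

Definition E2 (u : R) : R := betat u / Rabs (U u) * Im (V u - Vt u)%C.

Definition E3 (u : R) : R :=
  - (Im (V u) / Rabs (U u)) *
  (Re (V u - Vt u)%C / (sqrt (Rabs (U u)) + betat u)).

Definition E (u : R) : R := Rabs (E1 u + E2 u + E3 u).

(** [log T (u)] is the integral of [E] over (0, u], improper at 0. *)
Definition T (u : R) : R := exp (RInt_gen E (at_right 0) (at_point u)).

Definition beta (u : R) : R := sqrt (Rabs (U u)) / 2 * (T u + 1 / T u).
Definition Rad (u : R) : R := sqrt (Rabs (U u)) / 2 * (T u - 1 / T u).

Definition center (u : R) : C := (alpha u + Ci * beta u)%C.

End TMethod.

(** ** The potential and the solutions *)

Definition Vt (u : R) : C := RtoC (- (1 / (4 * u ^ 2))).

Definition V (zeta : C) (u : R) : C := (Vt u + zeta ^ 2)%C.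

Definition phit (zeta : C) (u : R) : C :=
  (sqrt u * ln (Cmod (zeta * u)%C) - Ci * sqrt u)%C.

Definition phi (zeta : C) (u : R) : C :=
  (- sqrt u *
   (Bessel_K0 (zeta * u)
    + (Ci * Carg zeta - ln 2 + euler_gamma + Ci) * Bessel_I0 (zeta * u)))%C.

(* Main.v *)
Require Import Defs.
From Stdlib Require Import Reals Lra Lia Factorial.
From Coquelicot Require Import Coquelicot.
Open Scope R_scope.

(** Everything scales: with [x = |zeta| u], [L = ln x] and [zeta = |zeta| e^(i theta)],
    only [theta] is left as a parameter.

    Near the origin, [phit' / phit] has real part [alpha = 1/(2u) + L/(u(1+L^2))] and
    imaginary part [betat = 1/(u(1+L^2))], so that [U = Re zeta^2 - betat^2].  This is
    negative as long as [x (1+L^2) < 1], and [x (1+L^2)] increases from 0 to at most 5/6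
    on [0 < x <= 2/3] ([mul_1_ln_sqr_le_5_6]).  Put [S = sqrt |U|].  Using the Riccati
    equation of [phit' / phit], the three error terms combine into
    [E = |Im V / S - (2 alpha + S'/S)|] ([E_phit]), which is of order
    [|zeta| x (1+L^2)^2 = O (|zeta| sqrt x)].  Hence [E] extends continuously by zero
    to the origin, its improper integral is an ordinary one, and [T] is at most
    [exp (O (|zeta| u))], uniformly in [zeta].

    A circle with center [a + i b] and radius [r >= 0] is invariant as soon as
    [r^2 - b^2 = Re V - a^2 - a'] and [|Im V - 2ab - b'| <= 2ar + r']: the first relation
    makes [|y - (a + i b)| - r] satisfy a linear differential inequality wherever it is
    positive, and a Gronwall argument forbids it to become positive
    ([gronwall_sign], [invariant_circle]).  For the circles of the T-method the first
    relation is the identity [beta^2 - R^2 = |U|], and the second one follows from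
    [T' = E T], [T >= 1] and [Im V >= 0] ([invariance_inequality]).

    For large [u], write [phi (u) = psi (x) / sqrt |zeta|], where
    [psi (x) = sqrt x ((L - i) P (x^2) - Q (x^2))] and [P], [Q] are the entire functions in
    the expansions of [I_0] and [K_0].  The power series recurrences give
    [psi'' = (kappa^2 - 1/(4x^2)) psi] with [kappa = e^(i theta)].  The imaginary part [W] of
    [conj psi * psi'] tends to 1 at the origin and has derivative
    [sin (2 theta) |psi|^2 >= 0], hence is positive everywhere; in particular [psi] has no
    zeros and [psi'/psi] lies in the upper half plane.  There, consider
    [D = |psi' - kappa psi|^2 / W = |y - kappa|^2 / Im y], where [y = psi'/psi].  Its sublevel
    sets are disks contained in the open upper half plane, and completing a square gives
    [D' <= - 2 cos theta D + 1 / sin (2 theta)] on [x >= 1/2]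
    ([lyapunov_derivative_bound]).  So [D] stays below a constant depending on [theta]
    only, which confines [y] to a fixed disk and yields both estimates. *)

(** * Calculus of complex-valued functions and a Gronwall argument *)

Lemma is_CDerive_pair (f : R -> C) (u l1 l2 : R) :
  is_derive (fun x => Re (f x)) u l1 -> is_derive (fun x => Im (f x)) u l2 ->
  is_CDerive f u (l1, l2).
Proof.
  intros H1 H2. unfold is_CDerive.
  pose proof (is_derive_plus (V := C_R_NormedModule) _ _ u _ _
    (is_derive_scal_l (V := C_R_NormedModule) _ u l1 (1, 0) H1)
    (is_derive_scal_l (V := C_R_NormedModule) _ u l2 (0, 1) H2)) as H.
  apply (is_derive_ext_loc _ f) in H.
  - replace (l1, l2) with
      (@plus C_R_NormedModule (@scal R_AbsRing C_R_NormedModule l1 (1, 0))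
         (@scal R_AbsRing C_R_NormedModule l2 (0, 1))); [exact H|].
    apply injective_projections; simpl; unfold plus, scal, mult; simpl; unfold mult; simpl; ring.
  - apply filter_forall. intros t.
    apply injective_projections; simpl; unfold plus, scal, mult; simpl; unfold mult; simpl;
    unfold Re, Im; ring.
Qed.

Lemma is_CDerive_Re (f : R -> C) (u : R) (l : C) :
  is_CDerive f u l -> is_derive (fun x => Re (f x)) u (Re l).
Proof.
  intros H. unfold is_CDerive, is_derive in H.
  pose proof (filterdiff_comp' f (fun z : C_R_NormedModule => fst z : R_NormedModule) u _ _ H
    (filterdiff_linear _ is_linear_fst)) as G.
  exact G.
Qed.

Lemma is_CDerive_Im (f : R -> C) (u : R) (l : C) :
  is_CDerive f u l -> is_derive (fun x => Im (f x)) u (Im l).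
Proof.
  intros H. unfold is_CDerive, is_derive in H.
  pose proof (filterdiff_comp' f (fun z : C_R_NormedModule => snd z : R_NormedModule) u _ _ H
    (filterdiff_linear _ is_linear_snd)) as G.
  exact G.
Qed.

Lemma is_CDerive_CDerive (f : R -> C) (u : R) (l : C) :
  is_CDerive f u l -> CDerive f u = l.
Proof.
  intros H. destruct l as [l1 l2]. unfold CDerive. f_equal; apply is_derive_unique.
  - exact (is_CDerive_Re f u _ H).
  - exact (is_CDerive_Im f u _ H).
Qed.

Lemma nonincreasing_of_derive (f df : R -> R) (a b : R) :
  a <= b ->
  (forall x, a <= x <= b -> continuity_pt f x) ->
  (forall x, a < x < b -> is_derive f x (df x)) ->
  (forall x, a < x < b -> df x <= 0) ->
  f b <= f a.
Proof.
  intros [Hab| ->] Hc Hd Hle; [|lra].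
  assert (pr : forall c, a < c < b -> derivable_pt f c).
  { intros c Hcc. exists (df c). apply is_derive_Reals. auto. }
  assert (pr2 : forall c, a < c < b -> derivable_pt id c) by (intros; apply derivable_pt_id).
  destruct (MVT f id a b pr pr2 Hab Hc) as [c [Hcc Heq]].
  { intros. apply derivable_continuous_pt, derivable_pt_id. }
  rewrite (derive_pt_eq_0 id c 1 _ (derivable_pt_lim_id c)) in Heq. unfold id in Heq.
  rewrite (derive_pt_eq_0 f c (df c)) in Heq.
  - specialize (Hle c Hcc). nra.
  - apply is_derive_Reals. auto.
Qed.

(** The differential inequality is needed only where [h] is positive: it is used between the
    last point where [h <= 0] and [b], where [exp (- K x) * h x] cannot increase.  This is
    what allows [h] to be of the form [|w| - r], which fails to be differentiable where
    [w = 0]. *)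
Lemma gronwall_sign (h : R -> R) (a b K : R) :
  a < b ->
  (forall x, a <= x <= b -> continuity_pt h x) ->
  (forall x, a < x < b -> 0 < h x -> exists l, is_derive h x l /\ l <= K * h x) ->
  h a <= 0 -> h b <= 0.
Proof.
  intros Hab Hc Hd Ha.
  destruct (Rle_lt_dec (h b) 0) as [|Hb]; [assumption|exfalso].
  destruct (completeness (fun t => a <= t <= b /\ h t <= 0)) as [s [Hs1 Hs2]].
  { exists b. intros t [Ht _]. lra. }
  { exists a. split; [lra|assumption]. }
  assert (Has : a <= s) by (apply Hs1; split; [lra|assumption]).
  assert (Hsb : s <= b) by (apply Hs2; intros t [Ht _]; lra).
  assert (Hpos : forall t, s < t <= b -> 0 < h t).
  { intros t Ht. destruct (Rle_lt_dec (h t) 0) as [H|]; [|assumption].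
    assert (t <= s) by (apply Hs1; split; [lra|assumption]). lra. }
  assert (Hhs : h s <= 0).
  { destruct (Rle_lt_dec (h s) 0) as [|Hp]; [assumption|exfalso].
    specialize (Hc s (conj Has Hsb)). rewrite continuity_pt_locally in Hc.
    destruct (Hc (mkposreal _ Hp)) as [d Hd'].
    assert (s <= s - d); [|destruct d; simpl in *; lra].
    apply Hs2. intros t [Ht1 Ht2].
    assert (t <= s) by (apply Hs1; split; assumption).
    destruct (Rle_lt_dec t (s - d)) as [|Hlt]; [assumption|exfalso].
    assert (Hb' : ball s d t).
    { unfold ball; simpl; unfold AbsRing_ball, abs, minus, plus, opp; simpl.
      apply Rabs_def1; destruct d; simpl in *; lra. }
    specialize (Hd' t Hb'). simpl in Hd'. apply Rabs_def2 in Hd'. lra. }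
  assert (Hsb' : s < b) by (destruct Hsb as [| ->]; [assumption|lra]).
  set (k := fun t => exp (- K * t) * h t).
  assert (Hk : k b <= k s).
  { apply (nonincreasing_of_derive k (Derive k)); [lra| | |].
    - intros x Hx. apply continuity_pt_mult; [|apply Hc; lra].
      apply derivable_continuous_pt. exists (exp (- K * x) * (- K)).
      apply is_derive_Reals. auto_derive; [trivial|ring].
    - intros x Hx. apply Derive_correct.
      destruct (Hd x) as [l [Hl _]]; [lra|apply Hpos; lra|].
      exists (- K * exp (- K * x) * h x + exp (- K * x) * l).
      apply (is_derive_mult (fun t => exp (- K * t)) h x (- K * exp (- K * x)) l);
        [|exact Hl|apply Rmult_comm].
      auto_derive; [trivial|ring].
    - intros x Hx.
      destruct (Hd x) as [l [Hl Hle]]; [lra|apply Hpos; lra|].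
      rewrite (is_derive_unique k x (- K * exp (- K * x) * h x + exp (- K * x) * l)).
      + pose proof (exp_pos (- K * x)). nra.
      + apply (is_derive_mult (fun t => exp (- K * t)) h x (- K * exp (- K * x)) l);
        [|exact Hl|apply Rmult_comm].
        auto_derive; [trivial|ring]. }
  unfold k in Hk. pose proof (exp_pos (- K * b)). pose proof (exp_pos (- K * s)). nra.
Qed.

(** Freezing [y] outside [[a, b]] turns the one-sided continuity at the endpoints into
    two-sided continuity, as the mean value theorem for [continuity_pt] requires. *)
Lemma continuous_clamp (y : R -> C) (a b : R) :
  a <= b ->
  @continuous_on R_UniformSpace C_UniformSpace (fun u => a <= u <= b) y ->
  forall u, @continuous R_UniformSpace C_UniformSpace
              (fun x => y (Rmax a (Rmin b x))) u.
Proof.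
  intros Hab Hy u. unfold continuous.
  assert (Hin : forall x, a <= Rmax a (Rmin b x) <= b).
  { intros x. split; [apply Rmax_l|]. apply Rmax_lub; [exact Hab|apply Rmin_l]. }
  refine (filterlim_comp _ _ _ (fun x => Rmax a (Rmin b x)) y _
    (within (fun x => a <= x <= b) (locally (Rmax a (Rmin b u)))) _ _ _).
  2: exact (Hy _ (Hin u)).
  intros P [d HP]. exists d. intros x Hx. apply HP; [|apply Hin].
  revert Hx. unfold ball; simpl; unfold AbsRing_ball, abs, minus, plus, opp; simpl.
  unfold Rmax, Rmin. intros Hx. apply Rabs_def2 in Hx.
  apply Rabs_def1; repeat destruct Rle_dec; lra.
Qed.

Lemma continuity_pt_Re (y : R -> C) (u : R) :
  @continuous R_UniformSpace C_UniformSpace y u -> continuity_pt (fun x => Re (y x)) u.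
Proof.
  intros H. apply continuity_pt_filterlim.
  apply (continuous_comp y (fun z : C_UniformSpace => fst z : R_UniformSpace) u H).
  destruct (y u) as [p q]. exact (continuous_fst p q).
Qed.

Lemma continuity_pt_Im (y : R -> C) (u : R) :
  @continuous R_UniformSpace C_UniformSpace y u -> continuity_pt (fun x => Im (y x)) u.
Proof.
  intros H. apply continuity_pt_filterlim.
  apply (continuous_comp y (fun z : C_UniformSpace => snd z : R_UniformSpace) u H).
  destruct (y u) as [p q]. exact (continuous_snd p q).
Qed.

Lemma continuity_pt_of_derive (f : R -> R) (u l : R) :
  is_derive f u l -> continuity_pt f u.
Proof.
  intros H. apply derivable_continuous_pt. exists l. now apply is_derive_Reals.
Qed.

(** * Circles carried by the Riccati flow *)

(** With [y = a + i b + (w1 + i w2)] and [y' = V - y^2], the quotient in the conclusion is the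
    derivative of [H = |y - (a + i b)|].  The relation between [r] and [b] turns it into
    [(w1 / H) (r^2 - H^2) + (w2 / H) (Vi - 2ab - db) - 2aH]; since the directions [w1 / H] and
    [w2 / H] are bounded by 1, everything that does not vanish on the circle is absorbed
    by the assumed inequality, and a multiple of [H - r] remains. *)
Lemma circle_distance_derivative_bound (w1 w2 a b r Vr Vi da db dr K : R) :
  let H := sqrt (w1 ^ 2 + w2 ^ 2) in
  0 < H - r -> 0 <= r ->
  r ^ 2 - b ^ 2 = Vr - a ^ 2 - da ->
  Rabs (Vi - 2 * a * b - db) <= 2 * a * r + dr ->
  H + r + 2 * Rabs a <= K ->
  (w1 * (Vr - ((a + w1) ^ 2 - (b + w2) ^ 2) - da)
   + w2 * (Vi - 2 * (a + w1) * (b + w2) - db)) / H - dr <= K * (H - r).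
Proof.
  intros H Hpos Hr HU HG HK.
  set (G := Vi - 2 * a * b - db) in *.
  assert (Hsq : H ^ 2 = w1 ^ 2 + w2 ^ 2) by (apply pow2_sqrt; nra).
  assert (HH : 0 < H) by lra.
  assert (Hc1 : Rabs (w1 / H) <= 1).
  { apply Rabs_le. split; [apply (Rmult_le_reg_r H _ _ HH)|apply (Rmult_le_reg_r H _ _ HH)];
    field_simplify; nra. }
  assert (Hc2 : Rabs (w2 / H) <= 1).
  { apply Rabs_le. split; [apply (Rmult_le_reg_r H _ _ HH)|apply (Rmult_le_reg_r H _ _ HH)];
    field_simplify; nra. }
  replace ((w1 * (Vr - ((a + w1) ^ 2 - (b + w2) ^ 2) - da)
   + w2 * (Vi - 2 * (a + w1) * (b + w2) - db)) / H - dr)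
   with (w1 / H * (r ^ 2 - H ^ 2) + w2 / H * G - 2 * a * H - dr).
  2: { replace Vr with (r ^ 2 - b ^ 2 + a ^ 2 + da) by lra.
       apply (Rmult_eq_reg_r H); [|lra]. unfold G. field_simplify; [|lra|lra].
       replace (H ^ 3) with (H * H ^ 2) by ring. rewrite !Hsq. ring. }
  apply Rabs_le_between in Hc1.
  assert (w2 / H * G <= Rabs G).
  { apply Rle_trans with (1 := Rle_abs _). rewrite Rabs_mult.
    pose proof (Rabs_pos G). nra. }
  pose proof (Rle_abs (- a)). rewrite Rabs_Ropp in H1.
  assert (w1 / H * (r ^ 2 - H ^ 2) <= (H - r) * (H + r)).
  { assert (0 <= (H - r) * (H + r)) by (apply Rmult_le_pos; lra).
    set (c := w1 / H) in *. nra. }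
  assert ((H - r) * (H + r + 2 * Rabs a) <= (H - r) * K) by (apply Rmult_le_compat_l; lra).
  nra.
Qed.

(** Criterion for a moving circle to be invariant under [y' = V - y^2].  The radius may vanish:
    comparing [|y - (a + i b)|] with [r], rather than their squares, keeps the
    Gronwall constant finite in that case. *)
Lemma invariant_circle (V : R -> C) (a b r da db dr : R -> R) (v0 v1 : R) (y : R -> C) :
  v0 < v1 ->
  (forall u, v0 <= u <= v1 ->
     is_derive a u (da u) /\ is_derive b u (db u) /\ is_derive r u (dr u)) ->
  (forall u, v0 < u < v1 ->
     0 <= r u /\ r u ^ 2 - b u ^ 2 = Re (V u) - a u ^ 2 - da u /\
     Rabs (Im (V u) - 2 * a u * b u - db u) <= 2 * a u * r u + dr u) ->
  Riccati_solution V v0 v1 y ->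
  Cmod (y v0 - (a v0, b v0))%C <= r v0 -> Cmod (y v1 - (a v1, b v1))%C <= r v1.
Proof.
  intros Hv Hder Hineq [Hcont Hric] H0.
  set (yc := fun u => y (Rmax v0 (Rmin v1 u))).
  assert (Hyc : forall u, v0 <= u <= v1 -> yc u = y u).
  { intros u Hu. unfold yc. f_equal. unfold Rmax, Rmin. repeat destruct Rle_dec; lra. }
  pose proof (continuous_clamp y v0 v1 (Rlt_le _ _ Hv) Hcont) as Hycc.
  fold yc in Hycc.
  set (w1 := fun u => Re (yc u) - a u). set (w2 := fun u => Im (yc u) - b u).
  set (N := fun u => sqrt (w1 u ^ 2 + w2 u ^ 2)).
  assert (HN : forall u, v0 <= u <= v1 -> Cmod (y u - (a u, b u))%C = N u).
  { intros u Hu. rewrite <- (Hyc u Hu). reflexivity. }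
  assert (Hca : forall u, v0 <= u <= v1 -> continuity_pt a u).
  { intros u Hu. exact (continuity_pt_of_derive _ _ _ (proj1 (Hder u Hu))). }
  assert (Hcr : forall u, v0 <= u <= v1 -> continuity_pt r u).
  { intros u Hu. exact (continuity_pt_of_derive _ _ _ (proj2 (proj2 (Hder u Hu)))). }
  assert (HcN : forall u, v0 <= u <= v1 -> continuity_pt N u).
  { intros u Hu.
    assert (continuity_pt w1 u).
    { apply continuity_pt_minus; [apply continuity_pt_Re, Hycc|auto]. }
    assert (continuity_pt w2 u).
    { apply continuity_pt_minus; [apply continuity_pt_Im, Hycc|].
      exact (continuity_pt_of_derive _ _ _ (proj1 (proj2 (Hder u Hu)))). }
    apply (continuity_pt_comp (fun t => w1 t ^ 2 + w2 t ^ 2) sqrt).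
    - apply continuity_pt_plus.
      + apply (continuity_pt_comp w1 (fun t => t ^ 2)); [assumption|].
        apply derivable_continuous_pt, derivable_pt_pow.
      + apply (continuity_pt_comp w2 (fun t => t ^ 2)); [assumption|].
        apply derivable_continuous_pt, derivable_pt_pow.
    - apply continuity_pt_sqrt. nra. }
  rewrite HN in H0 by lra. rewrite HN by lra.
  (* A uniform Gronwall constant on the compact interval. *)
  destruct (continuity_ab_maj (fun u => N u + r u + 2 * Rabs (a u)) v0 v1 (Rlt_le _ _ Hv))
    as [um [Hmax _]].
  { intros u Hu. apply continuity_pt_plus; [apply continuity_pt_plus; auto|].
    apply continuity_pt_mult; [apply continuity_pt_const; intros ? ?; reflexivity|].
    apply (continuity_pt_comp a Rabs); [auto|apply Rcontinuity_abs]. }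
  set (K := N um + r um + 2 * Rabs (a um)) in *.
  cut (N v1 - r v1 <= 0); [lra|].
  apply (gronwall_sign (fun u => N u - r u) v0 v1 K Hv); [| |lra].
  { intros u Hu. apply continuity_pt_minus; auto. }
  intros u Hu Hpos.
  destruct (Hineq u Hu) as [Hr [HU HG]].
  destruct (Hder u) as [Hda [Hdb Hdr]]; [lra|].
  specialize (Hric u Hu).
  assert (Hloc : locally u (fun t => y t = yc t)).
  { apply (locally_interval _ u v0 v1); [exact (proj1 Hu)|exact (proj2 Hu)|].
    simpl. intros t H1 H2. symmetry. apply Hyc. lra. }
  pose proof (is_derive_ext_loc y yc u _ Hloc Hric) as Hyd.
  assert (Hy1 : is_derive w1 u (Re (V u - y u ^ 2)%C - da u)).
  { apply (is_derive_minus (fun x => Re (yc x)) a u); [exact (is_CDerive_Re _ _ _ Hyd)|assumption]. }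
  assert (Hy2 : is_derive w2 u (Im (V u - y u ^ 2)%C - db u)).
  { apply (is_derive_minus (fun x => Im (yc x)) b u); [exact (is_CDerive_Im _ _ _ Hyd)|assumption]. }
  pose proof (circle_distance_derivative_bound (w1 u) (w2 u) (a u) (b u) (r u)
    (Re (V u)) (Im (V u)) (da u) (db u) (dr u) K) as Hb. simpl in Hb.
  eexists. split; [|apply Hb; auto].
  2: { apply Hmax. lra. }
  assert (Hsq : 0 < w1 u ^ 2 + w2 u ^ 2).
  { apply Rnot_le_lt. intros Hle. unfold N in Hpos. rewrite sqrt_neg_0 in Hpos by assumption. lra. }
  apply (is_derive_minus N r u); [|assumption].
  unfold N. auto_derive.
  { repeat split; [eexists; exact Hy1|eexists; exact Hy2|]. simpl in Hsq. lra. }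
  change (fun x => w1 x) with w1. change (fun x => w2 x) with w2.
  rewrite (is_derive_unique _ _ _ Hy1), (is_derive_unique _ _ _ Hy2).
  replace (a u + w1 u) with (Re (yc u)) by (unfold w1; ring).
  replace (b u + w2 u) with (Im (yc u)) by (unfold w2; ring).
  rewrite <- (Hyc u) by lra.
  assert (HS : sqrt (w1 u * (w1 u * 1) + w2 u * (w2 u * 1)) <> 0).
  { apply Rgt_not_eq, sqrt_lt_R0. simpl in Hsq. exact Hsq. }
  set (S := sqrt _) in *. simpl. unfold Re, Im. field. exact HS.
Qed.

(** * Estimates for x (1 + ln^2 x) *)

(** The derivative of [t (1 + ln^2 t)] is [(1 + ln t)^2]. *)
Lemma mul_1_ln_sqr_increasing (x y : R) :
  0 < x <= y -> x * (1 + ln x ^ 2) <= y * (1 + ln y ^ 2).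
Proof.
  intros Hxy.
  assert (Hd : forall t, x <= t <= y ->
    is_derive (fun t => - (t * (1 + ln t ^ 2))) t (- (1 + ln t) ^ 2)).
  { intros t Ht. auto_derive; [lra|]. field. lra. }
  apply Ropp_le_cancel.
  apply (nonincreasing_of_derive (fun t => - (t * (1 + ln t ^ 2))) (fun t => - (1 + ln t) ^ 2)).
  - lra.
  - intros t Ht. exact (continuity_pt_of_derive _ _ _ (Hd t Ht)).
  - intros t Ht. apply Hd. lra.
  - intros t Ht. pose proof (pow2_ge_0 (1 + ln t)). lra.
Qed.

Lemma mul_1_ln_sqr_le_1 (x : R) : 0 < x <= 1 -> x * (1 + ln x ^ 2) <= 1.
Proof.
  intros Hx. pose proof (mul_1_ln_sqr_increasing x 1 Hx) as H. rewrite ln_1 in H. lra.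
Qed.

(** The range extends beyond 1/2 so that [U] and [T] are differentiable at the right end of
    the interval [0 < x <= 1/2] too; the value 5/6 comes from [|ln (2/3)| <= 1/2]. *)
Lemma mul_1_ln_sqr_le_5_6 (x : R) : 0 < x <= 2 / 3 -> x * (1 + ln x ^ 2) <= 5 / 6.
Proof.
  intros Hx. pose proof (mul_1_ln_sqr_increasing x (2 / 3) Hx) as H.
  assert (H1 : ln (2 / 3) <= 0).
  { rewrite <- ln_1. apply ln_le; lra. }
  assert (H2 : - (1 / 2) <= ln (2 / 3)).
  { rewrite <- (ln_exp (- (1 / 2))). apply ln_le; [apply exp_pos|].
    rewrite exp_Ropp. pose proof (exp_ineq1 (1 / 2)).
    replace (2 / 3) with (/ (3 / 2)) by field. apply Rinv_le_contravar; lra. }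
  nra.
Qed.

(** Any power of the logarithm loses against a power of [x]: put [x = t^4], so that
    [1 + ln^2 x <= 16 (1 + ln^2 t)], and use [t (1 + ln^2 t) <= 1]. *)
Lemma mul_sqr_1_ln_sqr_le (x : R) :
  0 < x <= 1 -> x * (1 + ln x ^ 2) ^ 2 <= 256 * sqrt x.
Proof.
  intros Hx.
  set (s := sqrt x). set (t := sqrt s).
  assert (Hs : 0 < s) by (apply sqrt_lt_R0; lra).
  assert (Ht : 0 < t) by (apply sqrt_lt_R0; lra).
  assert (Es : s ^ 2 = x) by (apply pow2_sqrt; lra).
  assert (Et : t ^ 2 = s) by (apply pow2_sqrt; lra).
  assert (Ht1 : t <= 1).
  { apply Rnot_lt_le. intros H. assert (1 < s) by nra. nra. }
  assert (Hl : ln x = 4 * ln t).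
  { rewrite <- Es, <- Et. replace ((t ^ 2) ^ 2) with (t ^ 4) by ring.
    rewrite ln_pow by assumption. simpl. ring. }
  pose proof (mul_1_ln_sqr_le_1 t (conj Ht Ht1)) as H.
  rewrite Hl. set (l := ln t) in *.
  assert (H2 : (t * (1 + l ^ 2)) ^ 2 <= 1).
  { assert (0 <= t * (1 + l ^ 2)) by nra. nra. }
  assert (H3 : (1 + (4 * l) ^ 2) ^ 2 <= (16 * (1 + l ^ 2)) ^ 2).
  { assert (0 <= l ^ 2) by nra. nra. }
  rewrite <- Es.
  apply Rle_trans with (s ^ 2 * (16 * (1 + l ^ 2)) ^ 2).
  { apply Rmult_le_compat_l; [nra|assumption]. }
  replace (s ^ 2 * (16 * (1 + l ^ 2)) ^ 2) with (256 * s * (t * (1 + l ^ 2)) ^ 2)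
    by (rewrite <- Et; ring).
  nra.
Qed.

(** * The approximate solution *)

(** Real and imaginary part of [phit' / phit], where [rho = |zeta|]. *)
Definition alpha_model (rho u : R) : R :=
  1 / (2 * u) + ln (rho * u) / (u * (1 + ln (rho * u) ^ 2)).
Definition betat_model (rho u : R) : R := 1 / (u * (1 + ln (rho * u) ^ 2)).

Lemma one_plus_sqr_neq_0 (l : R) : 1 + l ^ 2 <> 0.
Proof. nra. Qed.

(** Real part of the Riccati equation with potential [- 1 / (4 u^2)]; the next lemma is its
    imaginary part. *)
Lemma is_derive_alpha_model (rho u : R) : 0 < rho -> 0 < u ->
  is_derive (alpha_model rho) u (- (1 / (4 * u ^ 2)) - alpha_model rho u ^ 2 + betat_model rho u ^ 2).
Proof.
  intros Hr Hu. unfold alpha_model, betat_model.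
  pose proof (one_plus_sqr_neq_0 (ln (rho * u))) as Hl.
  assert (0 < rho * u) by nra.
  auto_derive.
  { repeat split; try lra. apply Rmult_integral_contrapositive_currified; [lra|].
     simpl in Hl. exact Hl. }
  field. simpl in *. repeat split; try lra.
Qed.

Lemma is_derive_betat_model (rho u : R) : 0 < rho -> 0 < u ->
  is_derive (betat_model rho) u (- 2 * alpha_model rho u * betat_model rho u).
Proof.
  intros Hr Hu. unfold alpha_model, betat_model.
  pose proof (one_plus_sqr_neq_0 (ln (rho * u))) as Hl.
  assert (0 < rho * u) by nra.
  auto_derive.
  { repeat split; try lra. apply Rmult_integral_contrapositive_currified; [lra|].
     simpl in Hl. exact Hl. }
  field. simpl in *. repeat split; try lra.
Qed.

Lemma betat_model_pos (rho u : R) : 0 < u -> 0 < betat_model rho u.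
Proof.
  intros Hu. apply Rdiv_lt_0_compat; [lra|]. apply Rmult_lt_0_compat; nra.
Qed.

Lemma Rabs_alpha_model_le (rho u : R) : 0 < u -> Rabs (alpha_model rho u) <= 1 / u.
Proof.
  intros Hu. unfold alpha_model. set (l := ln (rho * u)).
  replace (1 / (2 * u) + l / (u * (1 + l ^ 2))) with ((1 + l) ^ 2 / (2 * (1 + l ^ 2)) / u)
    by (field; split; [nra|lra]).
  assert (0 < 1 + l ^ 2) by nra.
  rewrite Rabs_pos_eq.
  - apply Rmult_le_compat_r; [left; now apply Rinv_0_lt_compat|].
    apply (Rmult_le_reg_r (2 * (1 + l ^ 2))); [lra|].
    replace ((1 + l) ^ 2 / (2 * (1 + l ^ 2)) * (2 * (1 + l ^ 2))) with ((1 + l) ^ 2)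
      by (field; lra).
    pose proof (pow2_ge_0 (1 - l)). nra.
  - apply Rdiv_le_0_compat; [|lra]. apply Rdiv_le_0_compat; [apply pow2_ge_0|lra].
Qed.

Lemma Cmod_mult_pos (zeta : C) (u : R) : 0 < u -> Cmod (zeta * u)%C = Cmod zeta * u.
Proof. intros Hu. rewrite Cmod_mult, Cmod_R, Rabs_pos_eq; lra. Qed.

Lemma is_CDerive_phit (zeta : C) (u : R) : 0 < Cmod zeta -> 0 < u ->
  is_CDerive (phit zeta) u
    ((ln (Cmod zeta * u) / 2 + 1) / sqrt u, - 1 / (2 * sqrt u)).
Proof.
  intros Hz Hu. assert (Hs : 0 < sqrt u) by now apply sqrt_lt_R0.
  assert (Hsq : sqrt u ^ 2 = u) by (apply pow2_sqrt; lra).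
  apply is_CDerive_pair.
  - apply (is_derive_ext_loc (fun x => sqrt x * ln (Cmod zeta * x))).
    { apply (locally_interval _ u 0 p_infty); simpl; [lra|exact I|].
      intros x Hx _. rewrite Cmod_mult_pos by assumption. ring. }
    auto_derive; [repeat split; nra|].
    set (s := sqrt u) in *. rewrite <- Hsq. field. lra.
  - apply (is_derive_ext (fun x => - sqrt x)).
    { intros x. simpl. ring. }
    auto_derive; [assumption|]. field. lra.
Qed.

Lemma is_CDerive_CDerive_phit (zeta : C) (u : R) : 0 < Cmod zeta -> 0 < u ->
  is_CDerive (CDerive (phit zeta)) u (Vt u * phit zeta u)%C.
Proof.
  intros Hz Hu. assert (Hs : 0 < sqrt u) by now apply sqrt_lt_R0.
  assert (Hsq : sqrt u ^ 2 = u) by (apply pow2_sqrt; lra).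
  assert (Hloc : locally u (fun x => CDerive (phit zeta) x =
    ((ln (Cmod zeta * x) / 2 + 1) / sqrt x, - 1 / (2 * sqrt x)))).
  { apply (locally_interval _ u 0 p_infty); simpl; [lra|exact I|].
    intros x Hx _. apply is_CDerive_CDerive. now apply is_CDerive_phit. }
  unfold is_CDerive.
  apply (is_derive_ext_loc (V := C_R_NormedModule)
    (fun x => ((ln (Cmod zeta * x) / 2 + 1) / sqrt x, - 1 / (2 * sqrt x)))).
  { revert Hloc. apply filter_imp. intros x Hx. now symmetry. }
  replace (Vt u * phit zeta u)%C with
    (- (1 / (4 * u ^ 2)) * (sqrt u * ln (Cmod zeta * u)), - (1 / (4 * u ^ 2)) * (- sqrt u)).
  2: { unfold Vt, phit. rewrite Cmod_mult_pos by assumption.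
       apply injective_projections; simpl; ring. }
  apply is_CDerive_pair; simpl.
  - auto_derive; [repeat split; nra|].
    replace (u * (u * 1)) with (u ^ 2) by ring.
    set (s := sqrt u) in *. rewrite <- Hsq. field. lra.
  - auto_derive; [repeat split; nra|].
    replace (u * (u * 1)) with (u ^ 2) by ring.
    set (s := sqrt u) in *. rewrite <- Hsq. field. lra.
Qed.

Lemma phit_neq_0 (zeta : C) (u : R) : 0 < u -> phit zeta u <> RtoC 0.
Proof.
  intros Hu H. apply (f_equal snd) in H. unfold phit in H. simpl in H.
  pose proof (sqrt_lt_R0 u Hu). lra.
Qed.

Lemma log_deriv_phit (zeta : C) (u : R) : 0 < Cmod zeta -> 0 < u ->
  log_deriv (phit zeta) u = (alpha_model (Cmod zeta) u, betat_model (Cmod zeta) u).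
Proof.
  intros Hz Hu. assert (Hs : 0 < sqrt u) by now apply sqrt_lt_R0.
  assert (Hsq : sqrt u ^ 2 = u) by (apply pow2_sqrt; lra).
  unfold log_deriv. rewrite (is_CDerive_CDerive _ _ _ (is_CDerive_phit zeta u Hz Hu)).
  replace (phit zeta u) with ((sqrt u * ln (Cmod zeta * u), - sqrt u) : C).
  2: { unfold phit. rewrite Cmod_mult_pos by assumption.
       apply injective_projections; simpl; ring. }
  unfold alpha_model, betat_model. set (l := ln (Cmod zeta * u)). set (s := sqrt u) in *.
  assert (H1 : (1 + l ^ 2) <> 0) by nra.
  assert (H2 : s <> 0) by lra.
  rewrite <- Hsq.
  assert (H3 : (s * l) * (s * l) + s * s <> 0) by nra.
  apply injective_projections; simpl; field; repeat split; auto; simpl in H1; nra.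
Qed.

Lemma alpha_phit (zeta : C) (u : R) : 0 < Cmod zeta -> 0 < u ->
  alpha (phit zeta) u = alpha_model (Cmod zeta) u.
Proof. intros Hz Hu. unfold alpha. now rewrite log_deriv_phit. Qed.

Lemma betat_phit (zeta : C) (u : R) : 0 < Cmod zeta -> 0 < u ->
  betat (phit zeta) u = betat_model (Cmod zeta) u.
Proof. intros Hz Hu. unfold betat. now rewrite log_deriv_phit. Qed.

Lemma is_derive_alpha_phit (zeta : C) (u : R) : 0 < Cmod zeta -> 0 < u ->
  is_derive (alpha (phit zeta)) u
    (- (1 / (4 * u ^ 2)) - alpha_model (Cmod zeta) u ^ 2 + betat_model (Cmod zeta) u ^ 2).
Proof.
  intros Hz Hu. apply (is_derive_ext_loc (alpha_model (Cmod zeta))); [|now apply is_derive_alpha_model].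
  apply (locally_interval _ u 0 p_infty); simpl; [lra|exact I|].
  intros x Hx _. symmetry. now apply alpha_phit.
Qed.

Lemma U_phit (zeta : C) (u : R) : 0 < Cmod zeta -> 0 < u ->
  U (V zeta) (phit zeta) u = Re (zeta ^ 2)%C - betat_model (Cmod zeta) u ^ 2.
Proof.
  intros Hz Hu. unfold U.
  replace (Derive (alpha (phit zeta)) u) with
    (- (1 / (4 * u ^ 2)) - alpha_model (Cmod zeta) u ^ 2 + betat_model (Cmod zeta) u ^ 2)
    by (symmetry; apply is_derive_unique; now apply is_derive_alpha_phit).
  rewrite alpha_phit by assumption.
  unfold V, Vt, Re. simpl. ring.
Qed.

(** * The error function and its integral *)

Lemma betat_model_lower_bound (rho u : R) : 0 < rho -> 0 < u <= 2 / (3 * rho) ->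
  rho ^ 2 <= 25 / 36 * betat_model rho u ^ 2.
Proof.
  intros Hr [Hu Hu2].
  assert (Hx : 0 < rho * u <= 2 / 3).
  { split; [nra|]. apply (Rmult_le_compat_l rho) in Hu2; [|lra].
    replace (rho * (2 / (3 * rho))) with (2 / 3) in Hu2 by (field; lra). exact Hu2. }
  pose proof (mul_1_ln_sqr_le_5_6 _ Hx) as H.
  pose proof (betat_model_pos rho u Hu) as Hb.
  assert (Hbt : betat_model rho u * (u * (1 + ln (rho * u) ^ 2)) = 1).
  { unfold betat_model. field. split; nra. }
  set (b := betat_model rho u) in *. set (l := ln (rho * u)) in *.
  assert (rho <= 5 / 6 * b); [|nra].
  replace rho with (b * (rho * u * (1 + l ^ 2))); [nra|].
  transitivity (rho * (b * (u * (1 + l ^ 2)))); [ring|rewrite Hbt; ring].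
Qed.

(** Closed form of the error [E], with [rho = |zeta|] and [zeta^2 = c + i s]. *)
Definition rate (rho c s u : R) : R :=
  Rabs (s / sqrt (betat_model rho u ^ 2 - c) + 2 * alpha_model rho u * c / (betat_model rho u ^ 2 - c)).

Definition rate_ext (rho c s u : R) : R := if Rle_dec u 0 then 0 else rate rho c s u.

Lemma gap_bound (rho c u : R) : 0 < rho -> 0 < u <= 2 / (3 * rho) -> Rabs c <= rho ^ 2 ->
  11 / 36 * betat_model rho u ^ 2 <= betat_model rho u ^ 2 - c.
Proof.
  intros Hr Hu Hc. pose proof (betat_model_lower_bound rho u Hr Hu). apply Rabs_le_between in Hc. lra.
Qed.

Lemma gap_pos (rho c u : R) : 0 < rho -> 0 < u <= 2 / (3 * rho) -> Rabs c <= rho ^ 2 ->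
  0 < betat_model rho u ^ 2 - c.
Proof.
  intros Hr Hu Hc. pose proof (gap_bound rho c u Hr Hu Hc).
  pose proof (betat_model_pos rho u (proj1 Hu)). nra.
Qed.

(** By [gap_bound] the denominators are comparable to [betat] and [betat^2], so the two terms of
    [rate] are at most [36/11] and [72/11] times [rho x (1 + ln^2 x)^2], where [x = rho u];
    finally [108/11 * 256 < 2520]. *)
Lemma rate_le (rho c s u : R) : 0 < rho -> 0 < u <= 2 / (3 * rho) ->
  Rabs c <= rho ^ 2 -> Rabs s <= rho ^ 2 ->
  rate rho c s u <= 2520 * rho * sqrt (rho * u).
Proof.
  intros Hr Hu Hc Hs. destruct Hu as [Hu Hu2].
  assert (Hx : 0 < rho * u <= 2 / 3).
  { split; [nra|]. apply (Rmult_le_compat_l rho) in Hu2; [|lra].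
    replace (rho * (2 / (3 * rho))) with (2 / 3) in Hu2 by (field; lra). exact Hu2. }
  pose proof (mul_sqr_1_ln_sqr_le (rho * u)) as H1.
  pose proof (gap_bound rho c u Hr (conj Hu Hu2) Hc) as Hg.
  pose proof (betat_model_pos rho u Hu) as Hb.
  pose proof (Rabs_alpha_model_le rho u Hu) as Ha.
  unfold rate. set (G := betat_model rho u ^ 2 - c) in *. set (l := ln (rho * u)) in *.
  assert (Hbt : / betat_model rho u = u * (1 + l ^ 2)).
  { unfold betat_model. fold l. field. split; nra. }
  set (b := betat_model rho u) in *.
  assert (HG : 0 < G) by nra.
  assert (HS : 11 / 36 * b <= sqrt G).
  { rewrite <- (sqrt_pow2 (11 / 36 * b)) by lra. apply sqrt_le_1_alt. nra. }
  apply Rle_trans with (1 := Rabs_triang _ _).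
  assert (T1 : Rabs (s / sqrt G) <= 36 / 11 * rho * (rho * u * (1 + l ^ 2) ^ 2)).
  { unfold Rdiv at 1. rewrite Rabs_mult, Rabs_inv, (Rabs_pos_eq (sqrt G)) by apply sqrt_pos.
    apply Rle_trans with (rho ^ 2 * / (11 / 36 * b)).
    - apply Rmult_le_compat; [apply Rabs_pos|left; apply Rinv_0_lt_compat; lra|assumption|].
      apply Rinv_le_contravar; lra.
    - rewrite Rinv_mult, Hbt.
      replace (rho ^ 2 * (/ (11 / 36) * (u * (1 + l ^ 2)))) with
        (36 / 11 * rho * (rho * u * (1 + l ^ 2))) by field.
      apply Rmult_le_compat_l; [lra|]. apply Rmult_le_compat_l; [lra|].
      pose proof (pow2_ge_0 l). nra. }
  assert (T2 : Rabs (2 * alpha_model rho u * c / G) <= 72 / 11 * rho * (rho * u * (1 + l ^ 2) ^ 2)).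
  { unfold Rdiv at 1. rewrite !Rabs_mult, Rabs_inv, (Rabs_pos_eq G), (Rabs_pos_eq 2) by lra.
    apply Rle_trans with (2 * (1 / u) * rho ^ 2 * / (11 / 36 * b ^ 2)).
    - apply Rmult_le_compat.
      + apply Rmult_le_pos; [|apply Rabs_pos]. apply Rmult_le_pos; [lra|apply Rabs_pos].
      + left; apply Rinv_0_lt_compat; lra.
      + apply Rmult_le_compat; [apply Rmult_le_pos; [lra|apply Rabs_pos]|apply Rabs_pos| |assumption].
        apply Rmult_le_compat_l; lra.
      + apply Rinv_le_contravar; nra.
    - rewrite Rinv_mult, <- pow_inv, Hbt. right. field. lra. }
  assert (H2 : rho * u * (1 + l ^ 2) ^ 2 <= 256 * sqrt (rho * u)) by (apply H1; lra).
  set (z := rho * u * (1 + l ^ 2) ^ 2) in *.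
  assert (rho * z <= rho * (256 * sqrt (rho * u))) by (apply Rmult_le_compat_l; lra).
  assert (0 <= rho * sqrt (rho * u)) by (apply Rmult_le_pos; [lra|apply sqrt_pos]).
  nra.
Qed.

Lemma continuous_rate (rho c s u : R) : 0 < rho -> 0 < u <= 2 / (3 * rho) ->
  Rabs c <= rho ^ 2 -> continuous (rate rho c s) u.
Proof.
  intros Hr Hu Hc. pose proof (gap_pos rho c u Hr Hu Hc) as HG.
  pose proof (is_derive_betat_model rho u Hr (proj1 Hu)) as Hb.
  pose proof (is_derive_alpha_model rho u Hr (proj1 Hu)) as Ha.
  apply (continuous_comp
    (fun u => s / sqrt (betat_model rho u ^ 2 - c) + 2 * alpha_model rho u * c / (betat_model rho u ^ 2 - c)) Rabs).
  - apply (ex_derive_continuous (K := R_AbsRing) (V := R_NormedModule)).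
    pose proof (sqrt_lt_R0 _ HG) as HS. simpl in HG, HS. unfold Rminus in HG, HS.
    auto_derive.
    repeat split; try (apply Rgt_not_eq); try assumption; eexists; eassumption.
  - apply continuous_Rabs.
Qed.

(** At [u = 0] the extension is squeezed between 0 and the bound of [rate_le]. *)
Lemma continuous_rate_ext (rho c s u : R) : 0 < rho -> u < 2 / (3 * rho) ->
  Rabs c <= rho ^ 2 -> Rabs s <= rho ^ 2 -> continuous (rate_ext rho c s) u.
Proof.
  intros Hr Hu Hc Hs.
  destruct (Rtotal_order u 0) as [Hneg|[->|Hpos]].
  - apply (continuous_ext_loc _ (fun _ => 0)); [|apply continuous_const].
    apply (locally_interval _ u m_infty 0); simpl; [exact I|exact Hneg|].
    intros x _ Hx. unfold rate_ext. destruct Rle_dec; [reflexivity|lra].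
  - set (B := fun x => 2520 * rho * sqrt (rho * Rmax x 0)).
    assert (HB : continuous B 0).
    { apply (continuous_mult (fun _ => 2520 * rho) (fun x => sqrt (rho * Rmax x 0))).
      - apply continuous_const.
      - apply (continuous_comp (fun x => rho * Rmax x 0) sqrt); [|apply continuous_sqrt].
        apply (continuous_mult (fun _ => rho) (fun x => Rmax x 0)); [apply continuous_const|].
        apply continuity_pt_filterlim.
        intros eps Heps. exists eps. split; [assumption|].
        intros x [_ Hx]. revert Hx. unfold dist; simpl; unfold R_dist.
        intros Hx. apply Rabs_def2 in Hx. apply Rabs_def1; unfold Rmax; repeat destruct Rle_dec; lra. }
    assert (B0 : B 0 = 0).
    { unfold B. rewrite Rmax_left, Rmult_0_r, sqrt_0 by lra. ring. }
    assert (E0 : rate_ext rho c s 0 = 0).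
    { unfold rate_ext. destruct Rle_dec; [reflexivity|lra]. }
    unfold continuous. rewrite E0.
    refine (filterlim_le_le (F := locally 0) (fun _ => 0) _ B (Finite 0) _ _ _).
    + apply (locally_interval _ 0 m_infty (2 / (3 * rho))); simpl; [exact I|exact Hu|].
      intros x _ Hx. unfold rate_ext, B. destruct Rle_dec as [Hle|Hlt].
      * split; [lra|]. apply Rmult_le_pos; [lra|apply sqrt_pos].
      * rewrite Rmax_left by lra. split; [apply Rabs_pos|]. apply rate_le; auto; lra.
    + apply filterlim_const.
    + change (filterlim B (locally 0) (locally 0)). rewrite <- B0 at 2. exact HB.
  - apply (continuous_ext_loc _ (rate rho c s)).
    + apply (locally_interval _ u 0 p_infty); simpl; [exact Hpos|exact I|].
      intros x Hx _. unfold rate_ext. destruct Rle_dec; [lra|reflexivity].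
    + apply continuous_rate; auto; lra.
Qed.

Lemma ex_RInt_rate_ext (rho c s u v : R) : 0 < rho ->
  u < 2 / (3 * rho) -> v < 2 / (3 * rho) ->
  Rabs c <= rho ^ 2 -> Rabs s <= rho ^ 2 -> ex_RInt (rate_ext rho c s) u v.
Proof.
  intros Hr Hu Hv Hc Hs. apply (ex_RInt_continuous (V := R_CompleteNormedModule)).
  intros z Hz. apply continuous_rate_ext; auto.
  revert Hz. unfold Rmin, Rmax. repeat destruct Rle_dec; lra.
Qed.

Lemma is_derive_RInt_rate_ext (rho c s u : R) : 0 < rho -> u < 2 / (3 * rho) ->
  Rabs c <= rho ^ 2 -> Rabs s <= rho ^ 2 ->
  is_derive (fun x => RInt (rate_ext rho c s) 0 x) u (rate_ext rho c s u).
Proof.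
  intros Hr Hu Hc Hs.
  assert (0 < 2 / (3 * rho)) by (apply Rdiv_lt_0_compat; lra).
  apply (is_derive_RInt (V := R_NormedModule) _ _ 0); [|now apply continuous_rate_ext].
  apply (locally_interval _ u m_infty (2 / (3 * rho))); simpl; [exact I|exact Hu|].
  intros x _ Hx. apply (RInt_correct (V := R_CompleteNormedModule)).
  now apply ex_RInt_rate_ext.
Qed.

(** An integrand with a continuous extension to 0 has its ordinary integral as
    improper integral: the piece over [[0, a]] is at most [a] times the maximum. *)
Lemma is_RInt_gen_at_right_continuous (f g : R -> R) (u : R) :
  0 < u ->
  (forall x, 0 <= x <= u -> continuous g x) ->
  (forall x, 0 < x <= u -> f x = g x) ->
  is_RInt_gen f (at_right 0) (at_point u) (RInt g 0 u).
Proof.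
  intros Hu Hc Hfg.
  assert (Hex : forall x y, 0 <= x <= u -> 0 <= y <= u -> ex_RInt g x y).
  { intros x y Hx Hy. apply (ex_RInt_continuous (V := R_CompleteNormedModule)).
    intros z Hz. apply Hc. revert Hz. unfold Rmin, Rmax. repeat destruct Rle_dec; lra. }
  destruct (continuity_ab_maj (fun x => Rabs (g x)) 0 u (Rlt_le _ _ Hu)) as [xm [Hm _]].
  { intros x Hx. apply continuity_pt_filterlim.
    apply (continuous_comp g Rabs); [now apply Hc|apply continuous_Rabs]. }
  set (M := Rabs (g xm)) in Hm.
  assert (HM : 0 <= M) by apply Rabs_pos.
  intros P [eps HP].
  assert (He : 0 < Rmin u (eps / (M + 1))).
  { apply Rmin_pos; [assumption|]. apply Rdiv_lt_0_compat; [apply cond_pos|lra]. }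
  exists (fun a => 0 < a < Rmin u (eps / (M + 1))) (fun b => b = u).
  - exists (mkposreal _ He). simpl. intros a Ha Ha0. split; [assumption|].
    revert Ha. unfold ball; simpl; unfold AbsRing_ball, abs, minus, plus, opp; simpl.
    intros Ha. apply Rabs_def2 in Ha. lra.
  - reflexivity.
  - intros a b [Ha Ha2] ->. exists (RInt g a u).
    assert (Hau : a < u) by (eapply Rlt_le_trans; [exact Ha2|apply Rmin_l]).
    split; simpl.
    + apply (is_RInt_ext g).
      { intros x Hx. rewrite Rmin_left, Rmax_right in Hx by lra. symmetry. apply Hfg. lra. }
      apply (RInt_correct (V := R_CompleteNormedModule)). apply Hex; lra.
    + apply HP. unfold ball; simpl; unfold AbsRing_ball, abs, minus, plus, opp; simpl.
      rewrite <- (RInt_Chasles g 0 a u) by (apply Hex; lra).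
      unfold plus; simpl.
      replace (RInt g a u + - (RInt g 0 a + RInt g a u)) with (- RInt g 0 a) by ring.
      rewrite Rabs_Ropp.
      apply Rle_lt_trans with ((a - 0) * M).
      * apply (abs_RInt_le_const g 0 a M); [lra|apply Hex; lra|].
        intros t Ht. apply Hm. lra.
      * assert (a * (M + 1) < eps).
        { apply (Rmult_lt_reg_r (/ (M + 1))); [apply Rinv_0_lt_compat; lra|].
          replace (a * (M + 1) * / (M + 1)) with a by (field; lra).
          eapply Rlt_le_trans; [exact Ha2|apply Rmin_r]. }
        lra.
Qed.

Lemma Cmod_sqr (z : C) : Cmod (z ^ 2)%C = Cmod z ^ 2.
Proof.
  replace (z ^ 2)%C with (z * z)%C by (simpl; ring). rewrite Cmod_mult. ring.
Qed.

Lemma Rabs_Re_sqr_le (z : C) : Rabs (Re (z ^ 2)%C) <= Cmod z ^ 2.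
Proof. rewrite <- Cmod_sqr. eapply Rle_trans; [apply Rmax_l|apply Rmax_Cmod]. Qed.

Lemma Rabs_Im_sqr_le (z : C) : Rabs (Im (z ^ 2)%C) <= Cmod z ^ 2.
Proof. rewrite <- Cmod_sqr. eapply Rle_trans; [apply Rmax_r|apply Rmax_Cmod]. Qed.

Section ErrorFunction.
Variable zeta : C.
Let rho := Cmod zeta.
Let c := Re (zeta ^ 2)%C.
Let s := Im (zeta ^ 2)%C.
Hypothesis rho_pos : 0 < rho.

Lemma U_phit_neg (u : R) : 0 < u <= 2 / (3 * rho) -> U (V zeta) (phit zeta) u < 0.
Proof.
  intros Hu. rewrite U_phit; [|exact rho_pos|apply Hu].
  pose proof (gap_pos rho c u rho_pos Hu (Rabs_Re_sqr_le zeta)). unfold rho, c in *. lra.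
Qed.

Lemma Rabs_U_phit (u : R) : 0 < u <= 2 / (3 * rho) ->
  Rabs (U (V zeta) (phit zeta) u) = betat_model rho u ^ 2 - c.
Proof.
  intros Hu. rewrite Rabs_left by now apply U_phit_neg.
  rewrite U_phit; [|exact rho_pos|apply Hu]. unfold rho, c. ring.
Qed.

(** The terms [E2] and [E3] telescope: [c = betat^2 - S^2] with [S = sqrt |U|], so that
    [E3 = - s (betat - S) / S^2] and [E2 + E3 = s / S]. *)
Lemma E_phit (u : R) : 0 < u <= 2 / (3 * rho) ->
  E (V zeta) Vt (phit zeta) u = rate rho c s u.
Proof.
  intros Hu. unfold E, rate, Defs.E1, E2, E3. f_equal.
  rewrite Rabs_U_phit by assumption.
  rewrite alpha_phit, betat_phit by (first [exact rho_pos|apply Hu]). fold rho.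
  pose proof (gap_pos rho c u rho_pos Hu (Rabs_Re_sqr_le zeta)) as HG.
  pose proof (betat_model_pos rho u (proj1 Hu)) as Hb.
  assert (HV : forall x, (V zeta x - Vt x)%C = (zeta ^ 2)%C).
  { intros x. unfold V. simpl. ring. }
  replace (Derive (fun x => Re (V zeta x - Vt x)%C) u) with 0.
  2: { symmetry. rewrite (Derive_ext _ (fun _ => c)); [apply Derive_const|].
       intros x. now rewrite HV. }
  rewrite !HV. fold c s.
  replace (Im (V zeta u)) with s by (unfold V, Vt, s, Im; simpl; ring).
  assert (HS : 0 < sqrt (betat_model rho u ^ 2 - c)) by now apply sqrt_lt_R0.
  assert (HSq : sqrt (betat_model rho u ^ 2 - c) ^ 2 = betat_model rho u ^ 2 - c) by (apply pow2_sqrt; lra).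
  set (S := sqrt (betat_model rho u ^ 2 - c)) in *. set (b := betat_model rho u) in *.
  rewrite <- HSq.
  replace c with (b ^ 2 - S ^ 2) by lra.
  field. lra.
Qed.

Lemma is_RInt_gen_E_phit (u : R) : 0 < u < 2 / (3 * rho) ->
  is_RInt_gen (E (V zeta) Vt (phit zeta)) (at_right 0) (at_point u)
    (RInt (rate_ext rho c s) 0 u).
Proof.
  intros Hu. apply is_RInt_gen_at_right_continuous; [lra| |].
  - intros x Hx. apply continuous_rate_ext;
      [exact rho_pos|lra|apply Rabs_Re_sqr_le|apply Rabs_Im_sqr_le].
  - intros x Hx. rewrite E_phit by lra. unfold rate_ext. destruct Rle_dec; [lra|reflexivity].
Qed.

Lemma T_phit (u : R) : 0 < u < 2 / (3 * rho) ->
  T (V zeta) Vt (phit zeta) u = exp (RInt (rate_ext rho c s) 0 u).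
Proof.
  intros Hu. unfold T. f_equal.
  apply (is_RInt_gen_unique (V := R_CompleteNormedModule)
    (FFa := Proper_StrongProper _ (at_right_proper_filter 0))
    (FFb := Proper_StrongProper _ (at_point_filter u))).
  now apply is_RInt_gen_E_phit.
Qed.

Lemma rate_ext_nonneg (u : R) : 0 <= rate_ext rho c s u.
Proof. unfold rate_ext. destruct Rle_dec; [lra|apply Rabs_pos]. Qed.

Lemma T_phit_ge_1 (u : R) : 0 < u < 2 / (3 * rho) -> 1 <= T (V zeta) Vt (phit zeta) u.
Proof.
  intros Hu. rewrite T_phit by assumption. rewrite <- exp_0.
  assert (0 <= RInt (rate_ext rho c s) 0 u) as [H|<-]; [|left; now apply exp_increasing|right; reflexivity].
  apply RInt_ge_0; [lra| |].
  - apply ex_RInt_rate_ext; [exact rho_pos|lra|lra|apply Rabs_Re_sqr_le|apply Rabs_Im_sqr_le].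
  - intros. apply rate_ext_nonneg.
Qed.

Lemma T_phit_le (u : R) : 0 < u <= 1 / (2 * rho) ->
  T (V zeta) Vt (phit zeta) u <= exp 1260.
Proof.
  intros Hu.
  assert (H12 : 1 / (2 * rho) < 2 / (3 * rho)).
  { apply (Rmult_lt_reg_r (6 * rho)); [lra|]. field_simplify; lra. }
  assert (Hrc : rho * (1 / (2 * rho)) = 1 / 2) by (field; lra).
  rewrite T_phit by lra.
  assert (H : RInt (rate_ext rho c s) 0 u <= 1260).
  { apply Rle_trans with ((u - 0) * (2520 * rho)).
    - apply Rle_trans with (1 := Rle_abs _).
      apply (abs_RInt_le_const (rate_ext rho c s) 0 u); [lra| |].
      + apply ex_RInt_rate_ext; [exact rho_pos|lra|lra|apply Rabs_Re_sqr_le|apply Rabs_Im_sqr_le].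
      + intros t Ht. rewrite Rabs_pos_eq by apply rate_ext_nonneg.
        unfold rate_ext. destruct Rle_dec as [|Hlt]; [lra|].
        apply Rle_trans with (2520 * rho * sqrt (rho * t)).
        * apply rate_le; [exact rho_pos|lra|apply Rabs_Re_sqr_le|apply Rabs_Im_sqr_le].
        * assert (sqrt (rho * t) <= 1); [|nra].
          rewrite <- sqrt_1. apply sqrt_le_1_alt.
          assert (rho * t <= rho * (1 / (2 * rho))) by (apply Rmult_le_compat_l; lra). lra.
    - assert (rho * u <= rho * (1 / (2 * rho))) by (apply Rmult_le_compat_l; lra). nra. }
  destruct H as [H| ->]; [left; now apply exp_increasing|right; reflexivity].
Qed.

Lemma is_derive_T_phit (u : R) : 0 < u < 2 / (3 * rho) ->
  is_derive (T (V zeta) Vt (phit zeta)) u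
    (rate rho c s u * T (V zeta) Vt (phit zeta) u).
Proof.
  intros Hu.
  apply (is_derive_ext_loc (fun x => exp (RInt (rate_ext rho c s) 0 x))).
  { apply (locally_interval _ u 0 (2 / (3 * rho))); simpl; [lra|lra|].
    intros x Hx Hx2. symmetry. now apply T_phit. }
  rewrite T_phit by assumption.
  replace (rate rho c s u) with (rate_ext rho c s u)
    by (unfold rate_ext; destruct Rle_dec; [lra|reflexivity]).
  apply (is_derive_comp exp (RInt (rate_ext rho c s) 0)).
  - apply is_derive_exp.
  - apply is_derive_RInt_rate_ext; [exact rho_pos|lra|apply Rabs_Re_sqr_le|apply Rabs_Im_sqr_le].
Qed.

End ErrorFunction.

(** * Invariance of the circles of the T-method *)

(** Here [k] stands for [2 alpha + S'/S] and [err] for [T'/T], so that [k b + err r] and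
    [k r + err b] are [2 alpha b + b'] and [2 alpha r + r'].  As [b + r = S T] and [b - r = S / T],
    the conclusion splits into [s <= (k + err) S T] and [(k - err) S / T <= s].  Both hold
    because [err] bounds [|s/S - k|], while [s >= 0] and [T >= 1]. *)
Lemma invariance_inequality (S T k err s : R) :
  0 < S -> 1 <= T -> 0 <= s -> Rabs (s / S - k) <= err ->
  let b := S / 2 * (T + 1 / T) in let r := S / 2 * (T - 1 / T) in
  Rabs (s - (k * b + err * r)) <= k * r + err * b.
Proof.
  intros HS HT Hs Herr b r. apply Rabs_le_between in Herr.
  assert (Hi : T * / T = 1) by (field; lra).
  assert (Hi0 : 0 < / T <= 1).
  { split; [apply Rinv_0_lt_compat; lra|]. rewrite <- Rinv_1. apply Rinv_le_contravar; lra. }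
  assert (Hs' : s = s / S * S) by (field; lra).
  set (w := s / S) in *.
  assert (Hw : 0 <= w) by (unfold w; apply Rdiv_le_0_compat; lra).
  assert (Hbr : b + r = S * T) by (unfold b, r; field; lra).
  assert (Hbr' : b - r = S * / T) by (unfold b, r; field; lra).
  assert (HkE : w <= (k + err) * T) by nra.
  assert (HkE' : (k - err) * / T <= w) by nra.
  apply Rabs_le. split.
  - assert ((k - err) * (b - r) <= s); [|lra]. rewrite Hbr', Hs'.
    assert (S * ((k - err) * / T) <= S * w) by (apply Rmult_le_compat_l; lra). lra.
  - assert (s <= (k + err) * (b + r)); [|lra]. rewrite Hbr, Hs'.
    assert (S * w <= S * ((k + err) * T)) by (apply Rmult_le_compat_l; lra). lra.
Qed.

Lemma circles_invariant_phit (zeta : C) :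
  0 < Cmod zeta -> 0 <= Im (zeta ^ 2)%C ->
  circles_invariant (V zeta) (fun u => 0 < u <= 1 / (2 * Cmod zeta))
    (center (V zeta) Vt (phit zeta)) (Rad (V zeta) Vt (phit zeta)).
Proof.
  intros Hr Hs y v0 v1 Hv0 Hv1 Hv Hy.
  set (rho := Cmod zeta) in *. set (c := Re (zeta ^ 2)%C). set (s := Im (zeta ^ 2)%C) in *.
  assert (H12 : 1 / (2 * rho) < 2 / (3 * rho)).
  { apply (Rmult_lt_reg_r (6 * rho)); [lra|]. field_simplify; lra. }
  set (Tz := T (V zeta) Vt (phit zeta)).
  set (S := fun u => sqrt (betat_model rho u ^ 2 - c)).
  set (dS := fun u => - 2 * alpha_model rho u * betat_model rho u ^ 2 / S u).
  set (dT := fun u => rate rho c s u * Tz u).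
  assert (Hm : forall u, center (V zeta) Vt (phit zeta) u =
    (alpha (phit zeta) u, beta (V zeta) Vt (phit zeta) u)).
  { intros u. unfold center. apply injective_projections; simpl; ring. }
  rewrite !Hm.
  assert (HG : forall u, 0 < u < 2 / (3 * rho) -> 0 < betat_model rho u ^ 2 - c).
  { intros u Hu. apply gap_pos; [exact Hr|lra|apply Rabs_Re_sqr_le]. }
  assert (HSpos : forall u, 0 < u < 2 / (3 * rho) -> 0 < S u).
  { intros u Hu. now apply sqrt_lt_R0, HG. }
  assert (HSq : forall u, 0 < u < 2 / (3 * rho) -> S u ^ 2 = betat_model rho u ^ 2 - c).
  { intros u Hu. apply pow2_sqrt. left. now apply HG. }
  assert (HT1 : forall u, 0 < u < 2 / (3 * rho) -> 1 <= Tz u).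
  { intros u Hu. now apply T_phit_ge_1. }
  assert (HdS : forall u, 0 < u < 2 / (3 * rho) -> is_derive S u (dS u)).
  { intros u Hu. unfold dS, S.
    pose proof (is_derive_betat_model rho u Hr (proj1 Hu)) as Hb.
    specialize (HG u Hu). specialize (HSpos u Hu). unfold S in HSpos.
    auto_derive.
    - repeat split; [eexists; exact Hb|]. simpl in HG. exact HG.
    - change (fun x => betat_model rho x) with (betat_model rho). rewrite (is_derive_unique _ _ _ Hb).
      replace (betat_model rho u * (betat_model rho u * 1) + - c) with (betat_model rho u ^ 2 - c) by ring.
      field. lra. }
  assert (Hbeta : forall u, 0 < u < 2 / (3 * rho) ->
    beta (V zeta) Vt (phit zeta) u = S u / 2 * (Tz u + 1 / Tz u)).
  { intros u Hu. unfold beta. rewrite Rabs_U_phit by (first [exact Hr|fold rho; lra]). reflexivity. }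
  assert (HRad : forall u, 0 < u < 2 / (3 * rho) ->
    Rad (V zeta) Vt (phit zeta) u = S u / 2 * (Tz u - 1 / Tz u)).
  { intros u Hu. unfold Rad. rewrite Rabs_U_phit by (first [exact Hr|fold rho; lra]). reflexivity. }
  apply (invariant_circle (V zeta) (alpha (phit zeta)) (beta (V zeta) Vt (phit zeta))
    (Rad (V zeta) Vt (phit zeta))
    (fun u => - (1 / (4 * u ^ 2)) - alpha_model rho u ^ 2 + betat_model rho u ^ 2)
    (fun u => dS u / 2 * (Tz u + 1 / Tz u) + S u / 2 * (dT u - dT u / Tz u ^ 2))
    (fun u => dS u / 2 * (Tz u - 1 / Tz u) + S u / 2 * (dT u + dT u / Tz u ^ 2))
    v0 v1 y Hv); [| |exact Hy].
  - intros u Hu.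
    assert (Hu' : 0 < u < 2 / (3 * rho)) by lra.
    pose proof (is_derive_T_phit zeta Hr u Hu') as HdT. fold Tz rho c s in HdT.
    fold (dT u) in HdT.
    specialize (HdS u Hu'). specialize (HT1 u Hu').
    assert (Hloc : forall f g : R -> R, (forall u, 0 < u < 2 / (3 * rho) -> f u = g u) ->
      locally u (fun x => g x = f x)).
    { intros f g Hfg. apply (locally_interval _ u 0 (2 / (3 * rho))); simpl; [lra|lra|].
      intros x Hx Hx2. symmetry. apply Hfg. lra. }
    split; [|split].
    + now apply is_derive_alpha_phit.
    + apply (is_derive_ext_loc _ _ _ _ (Hloc _ _ Hbeta)).
      auto_derive.
      * repeat split; [eexists; exact HdS|eexists; exact HdT|eexists; exact HdT|lra].
      * change (fun x => S x) with S. change (fun x => Tz x) with Tz.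
        rewrite (is_derive_unique _ _ _ HdS), (is_derive_unique _ _ _ HdT). field. lra.
    + apply (is_derive_ext_loc _ _ _ _ (Hloc _ _ HRad)).
      auto_derive.
      * repeat split; [eexists; exact HdS|eexists; exact HdT|eexists; exact HdT|lra].
      * change (fun x => S x) with S. change (fun x => Tz x) with Tz.
        rewrite (is_derive_unique _ _ _ HdS), (is_derive_unique _ _ _ HdT). field. lra.
  - intros u Hu.
    assert (Hu' : 0 < u < 2 / (3 * rho)) by lra.
    specialize (HSpos u Hu'). specialize (HSq u Hu'). specialize (HT1 u Hu').
    rewrite Hbeta, HRad, alpha_phit by (assumption || lra). fold rho.
    replace (Im (V zeta u)) with s by (unfold V, Vt, s, Im; simpl; ring).
    replace (Re (V zeta u)) with (- (1 / (4 * u ^ 2)) + c) by (unfold V, Vt, c, Re; simpl; ring).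
    repeat split.
    + assert (1 / Tz u <= 1).
      { unfold Rdiv. rewrite Rmult_1_l, <- Rinv_1. apply Rinv_le_contravar; lra. }
      apply Rmult_le_pos; lra.
    + transitivity (- S u ^ 2); [field; lra|rewrite HSq; ring].
    + pose proof (invariance_inequality (S u) (Tz u) (- 2 * alpha_model rho u * c / S u ^ 2)
        (rate rho c s u) s HSpos HT1 Hs) as H.
      assert (Hrate : Rabs (s / S u - - 2 * alpha_model rho u * c / S u ^ 2) <= rate rho c s u).
      { right. unfold rate. f_equal. fold (S u). rewrite <- HSq. field. lra. }
      specialize (H Hrate). cbv zeta in H.
      assert (Hc : c = betat_model rho u ^ 2 - S u ^ 2) by lra.
      unfold dS, dT. set (e := rate rho c s u) in *. rewrite Hc in H.
      eapply Rle_trans; [right|eapply Rle_trans; [exact H|right]].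
      * f_equal. field. lra.
      * field. lra.
Qed.

(** * The Frobenius ansatz at a double exponent *)

(** Frobenius ansatz for [f'' = (- 1/(4x^2) + k) f], whose exponent 1/2 at the origin is double.
    Only even powers of [x] occur for the Bessel functions, hence the argument [x^2]. *)
Definition frobenius (A B : R -> R) (x : R) : R := sqrt x * (ln x * A (x ^ 2) + B (x ^ 2)).

Definition dfrobenius (A B dA dB : R -> R) (x : R) : R :=
  (ln x * A (x ^ 2) + B (x ^ 2)) / (2 * sqrt x)
  + sqrt x * (A (x ^ 2) / x + 2 * x * (ln x * dA (x ^ 2) + dB (x ^ 2))).

Lemma is_derive_comp_sqr (f df : R -> R) (x : R) :
  (forall s, is_derive f s (df s)) ->
  is_derive (fun t => f (t ^ 2)) x (2 * x * df (x ^ 2)).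
Proof.
  intros H.
  apply (is_derive_comp f (fun t => t ^ 2) x (df (x ^ 2)) (2 * x)); [apply H|].
  auto_derive; [trivial|ring].
Qed.

Lemma is_derive_frobenius (A B dA dB : R -> R) (x : R) : 0 < x ->
  (forall s, is_derive A s (dA s)) -> (forall s, is_derive B s (dB s)) ->
  is_derive (frobenius A B) x (dfrobenius A B dA dB x).
Proof.
  intros Hx HA HB. unfold frobenius, dfrobenius.
  set (A2 := fun t => A (t ^ 2)).
  assert (HA2 : is_derive A2 x (2 * x * dA (x ^ 2))) by exact (is_derive_comp_sqr A dA x HA).
  set (B2 := fun t => B (t ^ 2)).
  assert (HB2 : is_derive B2 x (2 * x * dB (x ^ 2))) by exact (is_derive_comp_sqr B dB x HB).
  pose proof (sqrt_lt_R0 x Hx).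
  change (A (x ^ 2)) with (A2 x). change (B (x ^ 2)) with (B2 x).
  apply (is_derive_ext (fun t => sqrt t * (ln t * A2 t + B2 t))); [reflexivity|].
  auto_derive.
  - repeat split; try assumption; eexists; eassumption.
  - change (fun x => A2 x) with A2. change (fun x => B2 x) with B2.
    rewrite (is_derive_unique _ _ _ HA2), (is_derive_unique _ _ _ HB2).
    field. lra.
Qed.

(** The operator [f'' + f / (4 x^2)] acts on the ansatz through
    [A |-> 4 (s A'' + A')], with the extra term [4 A'] from the logarithm in the regular part.
    In particular it preserves the ansatz. *)
Lemma is_derive_dfrobenius (A B dA dB ddA ddB : R -> R) (x : R) : 0 < x ->
  (forall s, is_derive A s (dA s)) -> (forall s, is_derive B s (dB s)) ->
  (forall s, is_derive dA s (ddA s)) -> (forall s, is_derive dB s (ddB s)) ->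
  is_derive (dfrobenius A B dA dB) x
    (- (1 / (4 * x ^ 2)) * frobenius A B x
     + 4 * frobenius (fun s => s * ddA s + dA s) (fun s => s * ddB s + dB s + dA s) x).
Proof.
  intros Hx HA HB HdA HdB. unfold frobenius, dfrobenius.
  set (A2 := fun t => A (t ^ 2)).
  assert (HA2 : is_derive A2 x (2 * x * dA (x ^ 2))) by exact (is_derive_comp_sqr A dA x HA).
  set (B2 := fun t => B (t ^ 2)).
  assert (HB2 : is_derive B2 x (2 * x * dB (x ^ 2))) by exact (is_derive_comp_sqr B dB x HB).
  set (dA2 := fun t => dA (t ^ 2)).
  assert (HdA2 : is_derive dA2 x (2 * x * ddA (x ^ 2))) by exact (is_derive_comp_sqr dA ddA x HdA).
  set (dB2 := fun t => dB (t ^ 2)).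
  assert (HdB2 : is_derive dB2 x (2 * x * ddB (x ^ 2))) by exact (is_derive_comp_sqr dB ddB x HdB).
  pose proof (sqrt_lt_R0 x Hx) as Hs.
  assert (Hsq : sqrt x ^ 2 = x) by (apply pow2_sqrt; lra).
  apply (is_derive_ext (fun t => (ln t * A2 t + B2 t) / (2 * sqrt t)
    + sqrt t * (A2 t / t + 2 * t * (ln t * dA2 t + dB2 t)))); [reflexivity|].
  change (A (x ^ 2)) with (A2 x). change (B (x ^ 2)) with (B2 x).
  change (dA (x ^ 2)) with (dA2 x) in *. change (dB (x ^ 2)) with (dB2 x) in *.
  auto_derive.
  - repeat split; try lra; eexists; eassumption.
  - change (fun x => A2 x) with A2. change (fun x => B2 x) with B2.
    change (fun x => dA2 x) with dA2. change (fun x => dB2 x) with dB2.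
    rewrite (is_derive_unique _ _ _ HA2), (is_derive_unique _ _ _ HB2),
      (is_derive_unique _ _ _ HdA2), (is_derive_unique _ _ _ HdB2).
    set (r := sqrt x) in *. clearbody A2 B2 dA2 dB2.
    generalize (A2 x) (B2 x) (dA2 x) (dB2 x) (ddA (x ^ 2)) (ddB (x ^ 2)) (ln x).
    intros a b a' b' a'' b'' l. rewrite <- Hsq. field. lra.
Qed.

(** All logarithms drop out of the limit of the Wronskian at the origin: with [L = ln x] and
    arguments [s = x^2], it equals [B1 A2 - B2 A1] plus [2 x^2] times a quadratic polynomial in [L]
    with bounded coefficients, and [x (1 + L^2) <= 1]. *)
Lemma frobenius_wronskian_pos (A1 B1 dA1 dB1 A2 B2 dA2 dB2 : R -> R) :
  (forall s, continuity_pt A1 s) -> (forall s, continuity_pt B1 s) ->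
  (forall s, continuity_pt dA1 s) -> (forall s, continuity_pt dB1 s) ->
  (forall s, continuity_pt A2 s) -> (forall s, continuity_pt B2 s) ->
  (forall s, continuity_pt dA2 s) -> (forall s, continuity_pt dB2 s) ->
  0 < B1 0 * A2 0 - B2 0 * A1 0 ->
  forall x0, 0 < x0 -> exists x, 0 < x < x0 /\
    0 < frobenius A1 B1 x * dfrobenius A2 B2 dA2 dB2 x - frobenius A2 B2 x * dfrobenius A1 B1 dA1 dB1 x.
Proof.
  intros CA1 CB1 CdA1 CdB1 CA2 CB2 CdA2 CdB2 H0 x0 Hx0.
  set (F := fun s => B1 s * A2 s - B2 s * A1 s) in *.
  set (m := F 0) in *.
  assert (Cabs : forall f, (forall s, continuity_pt f s) ->
    forall s, continuity_pt (fun t => Rabs (f t)) s).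
  { intros f Hf s. apply (continuity_pt_comp f Rabs); [apply Hf|apply Rcontinuity_abs]. }
  set (N := fun s => Rabs (A1 s) + Rabs (B1 s) + Rabs (dA1 s) + Rabs (dB1 s)
     + Rabs (A2 s) + Rabs (B2 s) + Rabs (dA2 s) + Rabs (dB2 s)).
  destruct (continuity_ab_maj N 0 1) as [sm [HM _]]; [lra| |].
  { intros s _. unfold N. repeat apply continuity_pt_plus; now apply Cabs. }
  set (M := N sm) in HM.
  assert (CF : continuity_pt F 0).
  { apply continuity_pt_minus; apply continuity_pt_mult; auto. }
  rewrite continuity_pt_locally in CF.
  assert (Hm2 : 0 < m / 2) by (assert (0 < m) by exact H0; lra).
  destruct (CF (mkposreal _ Hm2)) as [d Hd].
  assert (HM0 : 0 <= M).
  { unfold M, N. repeat apply Rplus_le_le_0_compat; apply Rabs_pos. }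
  assert (Hdn : 0 < 16 * M ^ 2 + 1) by nra.
  (* [d] makes [F (x^2)] larger than [m / 2], where [F = B1 A2 - B2 A1] and [m = F 0];
     the last entry makes the logarithmic terms smaller than [m / 2]. *)
  set (x := Rmin (Rmin (x0 / 2) 1) (Rmin (d / 2) (m / 2 / (16 * M ^ 2 + 1)))).
  assert (Hd0 := cond_pos d).
  assert (Hx : 0 < x).
  { unfold x. repeat apply Rmin_pos; try lra. now apply Rdiv_lt_0_compat. }
  assert (Hx1 : x <= x0 / 2 /\ x <= 1 /\ x <= d / 2 /\ x <= m / 2 / (16 * M ^ 2 + 1)).
  { unfold x. unfold Rmin. repeat destruct Rle_dec; lra. }
  destruct Hx1 as [Hx1 [Hx2 [Hx3 Hx4]]].
  exists x. split; [lra|].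
  assert (Hs : 0 <= x ^ 2 <= 1) by nra.
  specialize (HM (x ^ 2) Hs). unfold N in HM.
  assert (Hb : ball 0 d (x ^ 2)).
  { unfold ball; simpl; unfold AbsRing_ball, abs, minus, plus, opp; simpl.
    assert (x * (x * 1) <= x) by nra. apply Rabs_def1; nra. }
  specialize (Hd _ Hb). simpl in Hd. fold m in Hd.
  replace (x * (x * 1)) with (x ^ 2) in Hd by ring.
  apply Rabs_def2 in Hd. destruct Hd as [_ Hd]. unfold F in Hd.
  pose proof (mul_1_ln_sqr_le_1 x (conj Hx Hx2)) as Hl.
  pose proof (sqrt_lt_R0 x Hx) as Hr.
  assert (Hrq : sqrt x ^ 2 = x) by (apply pow2_sqrt; lra).
  unfold frobenius, dfrobenius. set (r := sqrt x) in *.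
  set (l := ln x) in *.
  set (a1 := A1 (x ^ 2)) in *. set (b1 := B1 (x ^ 2)) in *.
  set (a1' := dA1 (x ^ 2)) in *. set (b1' := dB1 (x ^ 2)) in *.
  set (a2 := A2 (x ^ 2)) in *. set (b2 := B2 (x ^ 2)) in *.
  set (a2' := dA2 (x ^ 2)) in *. set (b2' := dB2 (x ^ 2)) in *.
  pose proof (Rabs_pos a1); pose proof (Rabs_pos b1);
  pose proof (Rabs_pos a1'); pose proof (Rabs_pos b1');
  pose proof (Rabs_pos a2); pose proof (Rabs_pos b2);
  pose proof (Rabs_pos a2'); pose proof (Rabs_pos b2').
  replace (r * (l * a1 + b1) * ((l * a2 + b2) / (2 * r) + r * (a2 / x + 2 * x * (l * a2' + b2'))) -
    r * (l * a2 + b2) * ((l * a1 + b1) / (2 * r) + r * (a1 / x + 2 * x * (l * a1' + b1'))))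
    with (b1 * a2 - b2 * a1
      + 2 * x ^ 2 * ((l * a1 + b1) * (l * a2' + b2') - (l * a2 + b2) * (l * a1' + b1'))).
  2: { rewrite <- Hrq. field. lra. }
  assert (Hbd : forall a b, Rabs a <= M -> Rabs b <= M -> Rabs (l * a + b) <= M * (1 + Rabs l)).
  { intros a b Ha Hb'. eapply Rle_trans; [apply Rabs_triang|]. rewrite Rabs_mult.
    pose proof (Rabs_pos l). nra. }
  assert (Hpr : forall a b a' b', Rabs a <= M -> Rabs b <= M -> Rabs a' <= M -> Rabs b' <= M ->
    Rabs ((l * a + b) * (l * a' + b')) <= M ^ 2 * (2 * (1 + l ^ 2))).
  { intros a b a' b' G1 G2 G3 G4. rewrite Rabs_mult.
    apply Rle_trans with ((M * (1 + Rabs l)) * (M * (1 + Rabs l))).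
    - apply Rmult_le_compat; try apply Rabs_pos; now apply Hbd.
    - rewrite <- (pow2_abs l). pose proof (pow2_ge_0 (1 - Rabs l)). pose proof (pow2_ge_0 M). nra. }
  pose proof (Hpr a1 b1 a2' b2') as P1. pose proof (Hpr a2 b2 a1' b1') as P2.
  set (z1 := (l * a1 + b1) * (l * a2' + b2')) in *.
  set (z2 := (l * a2 + b2) * (l * a1' + b1')) in *.
  assert (Hz : - (M ^ 2 * (4 * (1 + l ^ 2))) <= z1 - z2).
  { assert (Q1 : Rabs z1 <= M ^ 2 * (2 * (1 + l ^ 2))) by (apply P1; lra).
    assert (Q2 : Rabs z2 <= M ^ 2 * (2 * (1 + l ^ 2))) by (apply P2; lra).
    apply Rabs_le_between in Q1. apply Rabs_le_between in Q2. lra. }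
  assert (Hxz : x * (16 * M ^ 2 + 1) <= m / 2).
  { apply (Rmult_le_compat_r (16 * M ^ 2 + 1)) in Hx4; [|lra].
    replace (m / 2 / (16 * M ^ 2 + 1) * (16 * M ^ 2 + 1)) with (m / 2) in Hx4 by (field; lra).
    exact Hx4. }
  assert (Hfin : 2 * x ^ 2 * - (M ^ 2 * (4 * (1 + l ^ 2))) <= 2 * x ^ 2 * (z1 - z2)).
  { apply Rmult_le_compat_l; [nra|exact Hz]. }
  assert (x * M ^ 2 * (x * (1 + l ^ 2)) <= x * M ^ 2 * 1).
  { apply Rmult_le_compat_l; [|exact Hl]. apply Rmult_le_pos; [lra|apply pow2_ge_0]. }
  nra.
Qed.

(** * The power series of the Bessel functions *)

Lemma CV_radius_infinite_of_bounded (a : nat -> R) :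
  (forall r, 0 <= r -> exists M, forall n, Rabs (a n) * r ^ n <= M) ->
  CV_radius a = p_infty.
Proof.
  intros H. destruct (CV_radius_bounded a) as [Hub _].
  assert (Hr : forall r : R, 0 <= r -> Rbar_le r (CV_radius a)).
  { intros r Hr. apply Hub. destruct (H r Hr) as [M HM]. exists M. intros n.
    rewrite Rabs_mult, (Rabs_pos_eq (r ^ n)) by now apply pow_le. apply HM. }
  destruct (CV_radius a) as [l| |]; [|reflexivity|].
  - specialize (Hr (Rmax 0 l + 1)). simpl in Hr.
    pose proof (Rmax_l 0 l). pose proof (Rmax_r 0 l). lra.
  - specialize (Hr 0 (Rle_refl 0)). contradiction.
Qed.

Lemma is_derive_PSeries_entire (a : nat -> R) (x : R) : CV_radius a = p_infty ->
  is_derive (PSeries a) x (PSeries (PS_derive a) x).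
Proof. intros H. apply is_derive_PSeries. now rewrite H. Qed.

(** The operator [x f'' + f'] maps [x^(n+1)] to [(n+1)^2 x^n]; it turns the differential
    equations of the Bessel functions into two-term recurrences. *)
Lemma PSeries_euler_operator (a : nat -> R) (x : R) : CV_radius a = p_infty ->
  x * PSeries (PS_derive (PS_derive a)) x + PSeries (PS_derive a) x
  = PSeries (fun n => INR (S n) ^ 2 * a (S n)) x.
Proof.
  intros H. rewrite <- PSeries_incr_1, <- PSeries_plus.
  - apply PSeries_ext. intros [|n]; unfold PS_plus, PS_derive, PS_incr_1, plus, zero; simpl; ring.
  - apply CV_radius_inside. now rewrite CV_radius_incr_1, !CV_radius_derive, H.
  - apply CV_radius_inside. now rewrite CV_radius_derive, H.
Qed.

Lemma PSeries_lin_comb2 (p q : R) (a b : nat -> R) (x : R) :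
  CV_radius a = p_infty -> CV_radius b = p_infty ->
  PSeries (fun n => p * a n + q * b n) x = p * PSeries a x + q * PSeries b x.
Proof.
  intros Ha Hb. rewrite <- !PSeries_scal, <- PSeries_plus.
  - reflexivity.
  - apply ex_pseries_scal; [apply Rmult_comm|]. apply CV_radius_inside. now rewrite Ha.
  - apply ex_pseries_scal; [apply Rmult_comm|]. apply CV_radius_inside. now rewrite Hb.
Qed.

Lemma PSeries_lin_comb3 (p q : R) (a b e : nat -> R) (x : R) :
  CV_radius a = p_infty -> CV_radius b = p_infty -> CV_radius e = p_infty ->
  PSeries (fun n => p * a n + q * b n + e n) x
  = p * PSeries a x + q * PSeries b x + PSeries e x.
Proof.
  intros Ha Hb He.
  assert (Hex : forall f, CV_radius f = p_infty -> ex_pseries f x)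
    by (intros f Hf; apply CV_radius_inside; now rewrite Hf).
  assert (Hsc : forall r f, CV_radius f = p_infty -> ex_pseries (PS_scal r f) x)
    by (intros r f Hf; apply ex_pseries_scal; [apply Rmult_comm|now apply Hex]).
  rewrite <- !PSeries_scal, <- !PSeries_plus; auto.
  apply ex_pseries_plus; auto.
Qed.

Lemma harmonic_0 : harmonic 0 = 0.
Proof. unfold harmonic. rewrite sum_n_m_zero; [reflexivity|lia]. Qed.

Lemma harmonic_S (n : nat) : harmonic (S n) = harmonic n + / INR (S n).
Proof. unfold harmonic. rewrite sum_n_Sm by lia. reflexivity. Qed.

Lemma harmonic_bounds (n : nat) : 0 <= harmonic n <= INR (fact n).
Proof.
  assert (H : 0 <= harmonic n <= INR n).
  { induction n as [|n IH]; [rewrite harmonic_0; simpl; lra|].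
    rewrite harmonic_S, S_INR. pose proof (RinvN_pos n). pose proof (pos_INR n).
    assert (/ (INR n + 1) <= 1).
    { rewrite <- Rinv_1 at 2. apply Rinv_le_contravar; lra. }
    lra. }
  split; [apply H|]. apply Rle_trans with (1 := proj2 H).
  apply le_INR. clear H. induction n as [|n IH]; [simpl; lia|].
  simpl. pose proof (lt_O_fact n). destruct n; simpl in *; nia.
Qed.

Section Coefficients.
Variable w : C.

(** Coefficients of [I_0 (z)] in powers of [s], where [z^2 / 4 = w s]. *)
Definition I0_coef (n : nat) : C := (w ^ n / (INR (fact n) ^ 2)%R)%C.

Lemma I0_coef_S (n : nat) : (RtoC (INR (S n) ^ 2) * I0_coef (S n))%C = (w * I0_coef n)%C.
Proof.
  unfold I0_coef. rewrite fact_simpl, mult_INR.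
  assert (H1 : INR (fact n) <> 0) by apply INR_fact_neq_0.
  assert (H2 : INR (S n) <> 0) by now apply not_0_INR.
  rewrite !RtoC_pow, RtoC_mult. simpl Cpow. field.
  split; intros H; apply RtoC_inj in H; auto.
Qed.

Lemma Cmod_I0_coef (n : nat) : Cmod (I0_coef n) = Cmod w ^ n / INR (fact n) ^ 2.
Proof.
  unfold I0_coef. pose proof (INR_fact_lt_0 n).
  rewrite Cmod_div by (intros H0; apply RtoC_inj in H0; nra).
  rewrite Cmod_R, (Rabs_pos_eq (_ ^ 2)) by apply pow2_ge_0. f_equal.
  induction n as [|n IH]; [apply Cmod_1|]. simpl. rewrite Cmod_mult, IH. reflexivity.
  apply INR_fact_lt_0.
Qed.

(** Covers the coefficients of [I_0] (weights 1) and of the second series in [K_0] (weights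
    [harmonic n <= n!]): one of the two factorials absorbs the weight, and
    [y^n / n!] is bounded for every [y]. *)
Lemma CV_radius_weighted_I0_coef (h g : nat -> R) :
  (forall n, 0 <= h n <= INR (fact n)) -> (forall n, Rabs (g n) <= Cmod (I0_coef n)) ->
  CV_radius (fun n => h n * g n) = p_infty.
Proof.
  intros Hh Hg. apply CV_radius_infinite_of_bounded. intros r Hr.
  destruct (maj_by_pos (fun n => (Cmod w * r) ^ n / INR (fact n))) as [M [_ HM]].
  { exists 0. apply cv_speed_pow_fact. }
  exists M. intros n. apply Rle_trans with (2 := HM n). apply Rle_trans with (2 := Rle_abs _).
  specialize (Hg n). specialize (Hh n). rewrite Cmod_I0_coef in Hg. pose proof (INR_fact_lt_0 n) as Hf.
  rewrite Rabs_mult, (Rabs_pos_eq (h n)) by apply Hh.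
  replace ((Cmod w * r) ^ n / INR (fact n)) with
    (INR (fact n) * (Cmod w ^ n / INR (fact n) ^ 2) * r ^ n)
    by (rewrite Rpow_mult_distr; field; lra).
  apply Rmult_le_compat_r; [now apply pow_le|].
  apply Rmult_le_compat; [apply Hh|apply Rabs_pos|apply Hh|exact Hg].
Qed.

End Coefficients.

Section Series.
Variable w : C.

(** Real and imaginary parts of the two entire functions in the expansion of [K_0]. *)
Definition I0_re := PSeries (fun n => Re (I0_coef w n)).
Definition I0_im := PSeries (fun n => Im (I0_coef w n)).
Definition H_re := PSeries (fun n => harmonic n * Re (I0_coef w n)).
Definition H_im := PSeries (fun n => harmonic n * Im (I0_coef w n)).

Lemma I0_coef_S_Re (n : nat) :
  INR (S n) ^ 2 * Re (I0_coef w (S n)) = Re w * Re (I0_coef w n) - Im w * Im (I0_coef w n).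
Proof.
  pose proof (f_equal Re (I0_coef_S w n)) as H. unfold Re, Im in *.
  cbn [fst snd Cmult RtoC] in H. lra.
Qed.

Lemma I0_coef_S_Im (n : nat) :
  INR (S n) ^ 2 * Im (I0_coef w (S n)) = Im w * Re (I0_coef w n) + Re w * Im (I0_coef w n).
Proof.
  pose proof (f_equal Im (I0_coef_S w n)) as H. unfold Re, Im in *.
  cbn [fst snd Cmult RtoC] in H. lra.
Qed.

Lemma CV_radius_harmonic_I0_coef_Re : CV_radius (fun n => harmonic n * Re (I0_coef w n)) = p_infty.
Proof.
  apply (CV_radius_weighted_I0_coef w); [apply harmonic_bounds|].
  intros n. eapply Rle_trans; [apply Rmax_l|apply Rmax_Cmod].
Qed.

Lemma CV_radius_harmonic_I0_coef_Im : CV_radius (fun n => harmonic n * Im (I0_coef w n)) = p_infty.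
Proof.
  apply (CV_radius_weighted_I0_coef w); [apply harmonic_bounds|].
  intros n. eapply Rle_trans; [apply Rmax_r|apply Rmax_Cmod].
Qed.

Lemma one_le_fact (n : nat) : 0 <= 1 <= INR (fact n).
Proof. split; [lra|]. apply (le_INR 1). pose proof (lt_O_fact n). lia. Qed.

Lemma CV_radius_I0_coef_Re : CV_radius (fun n => Re (I0_coef w n)) = p_infty.
Proof.
  rewrite <- (CV_radius_weighted_I0_coef w (fun _ => 1) (fun n => Re (I0_coef w n)) one_le_fact).
  - apply CV_radius_ext. intros n. ring.
  - intros n. eapply Rle_trans; [apply Rmax_l|apply Rmax_Cmod].
Qed.

Lemma CV_radius_I0_coef_Im : CV_radius (fun n => Im (I0_coef w n)) = p_infty.
Proof.
  rewrite <- (CV_radius_weighted_I0_coef w (fun _ => 1) (fun n => Im (I0_coef w n)) one_le_fact).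
  - apply CV_radius_ext. intros n. ring.
  - intros n. eapply Rle_trans; [apply Rmax_r|apply Rmax_Cmod].
Qed.

(** Bessel's equation for [P = I0_re + i I0_im] in the variable [s = x^2], namely
    [s P'' + P' = w P], split into real and imaginary parts. *)
Lemma I0_re_equation (x : R) :
  x * PSeries (PS_derive (PS_derive (fun n => Re (I0_coef w n)))) x
  + PSeries (PS_derive (fun n => Re (I0_coef w n))) x = Re w * I0_re x - Im w * I0_im x.
Proof.
  rewrite PSeries_euler_operator by apply CV_radius_I0_coef_Re.
  unfold I0_re, I0_im.
  replace (Re w * PSeries (fun n => Re (I0_coef w n)) x - Im w * PSeries (fun n => Im (I0_coef w n)) x)
    with (Re w * PSeries (fun n => Re (I0_coef w n)) x + - Im w * PSeries (fun n => Im (I0_coef w n)) x) by ring.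
  rewrite <- PSeries_lin_comb2 by (apply CV_radius_I0_coef_Re || apply CV_radius_I0_coef_Im).
  apply PSeries_ext. intros n. rewrite I0_coef_S_Re. ring.
Qed.

Lemma I0_im_equation (x : R) :
  x * PSeries (PS_derive (PS_derive (fun n => Im (I0_coef w n)))) x
  + PSeries (PS_derive (fun n => Im (I0_coef w n))) x = Im w * I0_re x + Re w * I0_im x.
Proof.
  rewrite PSeries_euler_operator by apply CV_radius_I0_coef_Im.
  unfold I0_re, I0_im.
  rewrite <- PSeries_lin_comb2 by (apply CV_radius_I0_coef_Re || apply CV_radius_I0_coef_Im).
  apply PSeries_ext. intros n. apply I0_coef_S_Im.
Qed.

(** With [Q = H_re + i H_im] one has [s Q'' + Q' = w Q + P']: the inhomogeneity comes from
    [harmonic (n+1) - harmonic n = 1 / (n+1)], and it is what cancels the extra term that the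
    logarithm produces in [is_derive_dfrobenius]. *)
Lemma H_re_equation (x : R) :
  x * PSeries (PS_derive (PS_derive (fun n => harmonic n * Re (I0_coef w n)))) x
  + PSeries (PS_derive (fun n => harmonic n * Re (I0_coef w n))) x
  = Re w * H_re x + - Im w * H_im x + PSeries (PS_derive (fun n => Re (I0_coef w n))) x.
Proof.
  rewrite PSeries_euler_operator by apply CV_radius_harmonic_I0_coef_Re.
  unfold H_re, H_im.
  rewrite <- PSeries_lin_comb3 by
    (apply CV_radius_harmonic_I0_coef_Re || apply CV_radius_harmonic_I0_coef_Im
     || (rewrite CV_radius_derive; apply CV_radius_I0_coef_Re)).
  apply PSeries_ext. intros n. unfold PS_derive. rewrite harmonic_S.
  replace (INR (S n) ^ 2 * ((harmonic n + / INR (S n)) * Re (I0_coef w (S n))))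
    with (harmonic n * (INR (S n) ^ 2 * Re (I0_coef w (S n))) + INR (S n) * Re (I0_coef w (S n)))
    by (field; now apply not_0_INR).
  rewrite I0_coef_S_Re. ring.
Qed.

Lemma H_im_equation (x : R) :
  x * PSeries (PS_derive (PS_derive (fun n => harmonic n * Im (I0_coef w n)))) x
  + PSeries (PS_derive (fun n => harmonic n * Im (I0_coef w n))) x
  = Im w * H_re x + Re w * H_im x + PSeries (PS_derive (fun n => Im (I0_coef w n))) x.
Proof.
  rewrite PSeries_euler_operator by apply CV_radius_harmonic_I0_coef_Im.
  unfold H_re, H_im.
  rewrite <- PSeries_lin_comb3 by
    (apply CV_radius_harmonic_I0_coef_Re || apply CV_radius_harmonic_I0_coef_Im
     || (rewrite CV_radius_derive; apply CV_radius_I0_coef_Im)).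
  apply PSeries_ext. intros n. unfold PS_derive. rewrite harmonic_S.
  replace (INR (S n) ^ 2 * ((harmonic n + / INR (S n)) * Im (I0_coef w (S n))))
    with (harmonic n * (INR (S n) ^ 2 * Im (I0_coef w (S n))) + INR (S n) * Im (I0_coef w (S n)))
    by (field; now apply not_0_INR).
  rewrite I0_coef_S_Im. ring.
Qed.

Lemma I0_coef_pow (x : R) (k : nat) :
  ((w * RtoC x) ^ k / (INR (fact k) ^ 2)%R)%C = (I0_coef w k * RtoC (x ^ k))%C.
Proof.
  unfold I0_coef. rewrite Cpow_mult_l, <- (RtoC_pow x k). field.
  intros H. apply RtoC_inj in H. pose proof (INR_fact_lt_0 k). nra.
Qed.

Lemma Bessel_I0_series (z : C) (x : R) : (z ^ 2 / 4)%C = (w * RtoC x)%C ->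
  Bessel_I0 z = (I0_re x, I0_im x).
Proof.
  intros Hz. unfold Bessel_I0, CSeries, I0_re, I0_im, PSeries.
  f_equal; apply Series_ext; intros k; rewrite Hz, I0_coef_pow; unfold Re, Im; simpl; ring.
Qed.

Lemma Bessel_K0_series (z : C) (x : R) : (z ^ 2 / 4)%C = (w * RtoC x)%C ->
  Bessel_K0 z = (- (Clog (z / 2) + euler_gamma) * (I0_re x, I0_im x) + (H_re x, H_im x))%C.
Proof.
  intros Hz. unfold Bessel_K0. rewrite (Bessel_I0_series z x Hz). f_equal.
  unfold CSeries, H_re, H_im, PSeries.
  f_equal; apply Series_ext; intros k; rewrite Hz, I0_coef_pow; unfold Re, Im; simpl; ring.
Qed.

End Series.

(** * A Lyapunov function for the Riccati flow at infinity *)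

(** Throughout, [psi = f1 + i f2] solves [psi'' = (kappa^2 - 1/(4x^2)) psi] with [kappa = c + i s]
    on the unit circle, and [W] is the imaginary part of [conj psi * psi'], the Wronskian of
    [f1] and [f2]. *)
Section Lyapunov.
Variables (c s : R) (f1 f2 d1 d2 : R -> R).
Hypotheses (c_pos : 0 < c) (s_pos : 0 < s) (unit_circle : c ^ 2 + s ^ 2 = 1).
Hypothesis f1_derive : forall x, 0 < x -> is_derive f1 x (d1 x).
Hypothesis f2_derive : forall x, 0 < x -> is_derive f2 x (d2 x).
Hypothesis d1_derive : forall x, 0 < x ->
  is_derive d1 x (- (1 / (4 * x ^ 2)) * f1 x + ((c ^ 2 - s ^ 2) * f1 x - 2 * c * s * f2 x)).
Hypothesis d2_derive : forall x, 0 < x ->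
  is_derive d2 x (- (1 / (4 * x ^ 2)) * f2 x + (2 * c * s * f1 x + (c ^ 2 - s ^ 2) * f2 x)).

Let W x := f1 x * d2 x - f2 x * d1 x.
Hypothesis W_pos_near_0 : forall x0, 0 < x0 -> exists x, 0 < x < x0 /\ 0 < W x.

(** The derivative is [Im (conj psi * psi'')], to which the real part of the potential does not
    contribute. *)
Lemma is_derive_wronskian (x : R) : 0 < x -> is_derive W x (2 * c * s * (f1 x ^ 2 + f2 x ^ 2)).
Proof.
  intros Hx. unfold W.
  pose proof (f1_derive x Hx) as H1. pose proof (f2_derive x Hx) as H2.
  pose proof (d1_derive x Hx) as H3. pose proof (d2_derive x Hx) as H4.
  auto_derive.
  - repeat split; eexists; eassumption.
  - change (fun x => f1 x) with f1. change (fun x => f2 x) with f2.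
    change (fun x => d1 x) with d1. change (fun x => d2 x) with d2.
    rewrite (is_derive_unique _ _ _ H1), (is_derive_unique _ _ _ H2),
      (is_derive_unique _ _ _ H3), (is_derive_unique _ _ _ H4).
    field. lra.
Qed.

Lemma wronskian_pos (x : R) : 0 < x -> 0 < W x.
Proof.
  intros Hx. destruct (W_pos_near_0 x Hx) as [x1 [Hx1 HW]].
  apply Rlt_le_trans with (1 := HW).
  apply Ropp_le_cancel.
  apply (nonincreasing_of_derive (fun t => - W t)
    (fun t => - (2 * c * s * (f1 t ^ 2 + f2 t ^ 2)))); [lra| | |].
  - intros t Ht. apply (continuity_pt_opp W).
    eapply continuity_pt_of_derive, is_derive_wronskian. lra.
  - intros t Ht. apply (is_derive_opp W). apply is_derive_wronskian. lra.
  - intros t Ht. assert (0 < c * s) by (apply Rmult_lt_0_compat; assumption).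
    pose proof (pow2_ge_0 (f1 t)). pose proof (pow2_ge_0 (f2 t)). nra.
Qed.

(* [a1 + i a2 = psi' - kappa psi], hence [D = |y - kappa|^2 / Im y] for [y = psi'/psi]. *)
Let a1 x := d1 x - (c * f1 x - s * f2 x).
Let a2 x := d2 x - (s * f1 x + c * f2 x).
Let D x := (a1 x ^ 2 + a2 x ^ 2) / W x.

(** With [a = a1 + i a2] and [q = - 1/(4x^2)], one has [a' = - kappa a + q psi], so the numerator
    [|a|^2] decays at rate [2c] up to the cross term [2 q Re (conj a * psi)].  The growth of [W],
    at rate [2 c s |psi|^2 / W], contributes a negative term to [D'] that is quadratic in the same
    quantities and absorbs the cross term at the cost of [q^2 / (2 c s)].  On [x > 1/2] one has
    [q^2 <= 1]. *)
Lemma lyapunov_derivative_bound (x : R) : 1 / 2 < x ->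
  exists l, is_derive D x l /\ l <= - (2 * c) * D x + 1 / (2 * c * s).
Proof.
  intros Hx. assert (Hx0 : 0 < x) by lra.
  pose proof (f1_derive x Hx0) as H1. pose proof (f2_derive x Hx0) as H2.
  pose proof (d1_derive x Hx0) as H3. pose proof (d2_derive x Hx0) as H4.
  pose proof (is_derive_wronskian x Hx0) as HW. pose proof (wronskian_pos x Hx0) as HWp.
  set (q := - (1 / (4 * x ^ 2))) in *.
  assert (Hq : q ^ 2 <= 1).
  { assert (0 <= 1 / (4 * x ^ 2) <= 1); [|unfold q; nra].
    split; [apply Rdiv_le_0_compat; nra|].
    apply (Rmult_le_reg_r (4 * x ^ 2)); [nra|].
    replace (1 / (4 * x ^ 2) * (4 * x ^ 2)) with 1 by (field; lra). nra. }
  set (X := a1 x * f1 x + a2 x * f2 x).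
  set (N := f1 x ^ 2 + f2 x ^ 2) in *.
  set (A := a1 x ^ 2 + a2 x ^ 2).
  set (s2 := 2 * c * s) in *.
  assert (Hs2 : 0 < s2) by (unfold s2; assert (0 < c * s) by (apply Rmult_lt_0_compat; assumption); lra).
  assert (HCS : X ^ 2 <= A * N).
  { assert (A * N - X ^ 2 = (a1 x * f2 x - a2 x * f1 x) ^ 2) by (unfold A, N, X; ring).
    pose proof (pow2_ge_0 (a1 x * f2 x - a2 x * f1 x)). lra. }
  exists (((- 2 * c * A + 2 * q * X) * W x - A * (s2 * N)) / W x ^ 2). split.
  - apply (is_derive_div (fun t => a1 t ^ 2 + a2 t ^ 2) W x (- 2 * c * A + 2 * q * X) (s2 * N));
      [|exact HW|lra].
    unfold a1, a2. auto_derive.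
    + repeat split; eexists; eassumption.
    + change (fun x => f1 x) with f1. change (fun x => f2 x) with f2.
      change (fun x => d1 x) with d1. change (fun x => d2 x) with d2.
      rewrite (is_derive_unique _ _ _ H1), (is_derive_unique _ _ _ H2),
        (is_derive_unique _ _ _ H3), (is_derive_unique _ _ _ H4).
      unfold A, X, a1, a2, s2. ring.
  - assert (Hkey : s2 * (2 * q * X * W x - A * (s2 * N)) <= W x ^ 2).
    { pose proof (pow2_ge_0 (s2 * X - q * W x)).
      assert (s2 ^ 2 * X ^ 2 <= s2 ^ 2 * (A * N)) by (apply Rmult_le_compat_l; [apply pow2_ge_0|assumption]).
      assert (q ^ 2 * W x ^ 2 <= 1 * W x ^ 2) by (apply Rmult_le_compat_r; [apply pow2_ge_0|assumption]).
      nra. }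
    unfold D. fold A.
    apply (Rmult_le_reg_r (s2 * W x ^ 2)); [apply Rmult_lt_0_compat; [assumption|nra]|].
    replace (((-2 * c * A + 2 * q * X) * W x - A * (s2 * N)) / W x ^ 2 * (s2 * W x ^ 2))
      with (s2 * (2 * q * X * W x - A * (s2 * N)) - 2 * c * A * W x * s2) by (field; lra).
    replace ((- (2 * c) * (A / W x) + 1 / s2) * (s2 * W x ^ 2))
      with (W x ^ 2 - 2 * c * A * W x * s2) by (field; lra).
    lra.
Qed.

(** The inequality for [D'] makes [D] decrease wherever it exceeds [1 / (2 c s) / (2 c)]. *)
Lemma lyapunov_bounded : exists D0, 0 <= D0 /\ forall x, 1 / 2 < x -> D x <= D0.
Proof.
  assert (Hcs : 0 < c * s) by (apply Rmult_lt_0_compat; assumption).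
  set (D0 := Rmax (D (1 / 2)) (1 / (2 * c * s) / (2 * c))).
  exists D0. split.
  { apply Rle_trans with (2 := Rmax_r _ _). left.
    repeat apply Rdiv_lt_0_compat; lra. }
  intros x Hx.
  cut (D x - D0 <= 0); [lra|].
  apply (gronwall_sign (fun t => D t - D0) (1 / 2) x 0); [exact Hx| | |].
  - intros t Ht. apply continuity_pt_minus; [|apply continuity_pt_const; intros ? ?; reflexivity].
    assert (Ht0 : 0 < t) by lra.
    assert (Hc : forall f l, is_derive f t l -> continuity_pt f t)
      by (intros f l; apply continuity_pt_of_derive).
    apply (continuity_pt_div (fun t => a1 t ^ 2 + a2 t ^ 2) W).
    + eapply Hc. apply Derive_correct.
      pose proof (f1_derive t Ht0) as H1. pose proof (f2_derive t Ht0) as H2.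
      pose proof (d1_derive t Ht0) as H3. pose proof (d2_derive t Ht0) as H4.
      unfold a1, a2. auto_derive. repeat split; eexists; eassumption.
    + eapply Hc, is_derive_wronskian, Ht0.
    + apply Rgt_not_eq, wronskian_pos, Ht0.
  - intros t Ht Hpos.
    destruct (lyapunov_derivative_bound t (proj1 Ht)) as [l [Hl Hle]].
    exists l. split.
    + replace l with (l - 0) by ring.
      apply (is_derive_minus D (fun _ => D0)); [exact Hl|now auto_derive].
    + assert (1 / (2 * c * s) / (2 * c) <= D0) by apply Rmax_r.
      assert (1 / (2 * c * s) <= D0 * (2 * c)).
      { apply (Rmult_le_reg_r (/ (2 * c))); [apply Rinv_0_lt_compat; lra|].
        replace (D0 * (2 * c) * / (2 * c)) with D0 by (field; lra). exact H. }
      nra.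
  - assert (D (1 / 2) <= D0) by apply Rmax_l. lra.
Qed.

(** The constraint [|y - kappa|^2 <= D0 * Im y] places [y] in a disk inside the open upper half
    plane: it gives [Im y <= 2 s + D0], [Im y >= s^2 / (2 s + D0)] and
    [|Re y - c| <= 2 + D0]. *)
Lemma log_derivative_bounds : exists K, 0 < K /\ forall x, 1 / 2 < x ->
  0 < f1 x ^ 2 + f2 x ^ 2 /\
  Rabs ((d1 x * f1 x + d2 x * f2 x) / (f1 x ^ 2 + f2 x ^ 2)) <= K /\
  / K <= (d2 x * f1 x - d1 x * f2 x) / (f1 x ^ 2 + f2 x ^ 2).
Proof.
  destruct lyapunov_bounded as [D0 [HD0 HD]].
  assert (Hs1 : s <= 1) by nra. assert (Hc1 : c <= 1) by nra.
  set (K := 3 + D0 + (2 * s + D0) / s ^ 2).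
  assert (Hfr : 0 < (2 * s + D0) / s ^ 2) by (apply Rdiv_lt_0_compat; nra).
  exists K. split; [unfold K; lra|].
  intros x Hx. specialize (HD x Hx).
  pose proof (wronskian_pos x) as HW. specialize (HW ltac:(lra)).
  assert (HN : 0 < f1 x ^ 2 + f2 x ^ 2).
  { destruct (Req_dec (f1 x) 0) as [E1|]; [|nra].
    destruct (Req_dec (f2 x) 0) as [E2|]; [|nra].
    exfalso. unfold W in HW. rewrite E1, E2 in HW. lra. }
  split; [exact HN|].
  set (N := f1 x ^ 2 + f2 x ^ 2) in *.
  set (Y1 := (d1 x * f1 x + d2 x * f2 x) / N). set (Y2 := (d2 x * f1 x - d1 x * f2 x) / N).
  assert (HY2 : Y2 = W x / N) by (unfold Y2, W; f_equal; ring).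
  assert (HA : (a1 x ^ 2 + a2 x ^ 2) / N = (Y1 - c) ^ 2 + (Y2 - s) ^ 2).
  { unfold Y1, Y2, a1, a2, N. field. unfold N in HN. lra. }
  assert (HY2p : 0 < Y2) by (rewrite HY2; now apply Rdiv_lt_0_compat).
  assert (Hdisc : (Y1 - c) ^ 2 + (Y2 - s) ^ 2 <= D0 * Y2).
  { rewrite <- HA, HY2.
    replace ((a1 x ^ 2 + a2 x ^ 2) / N) with (D x * (W x / N)) by (unfold D; field; lra).
    apply Rmult_le_compat_r; [|exact HD]. rewrite <- HY2. lra. }
  pose proof (pow2_ge_0 (Y1 - c)). pose proof (pow2_ge_0 (Y2 - s)).
  assert (HYup : Y2 <= 2 * s + D0) by nra.
  assert (HYlow : s ^ 2 <= (2 * s + D0) * Y2) by nra.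
  split.
  - assert (Hsq : (Y1 - c) ^ 2 <= (2 + D0) ^ 2) by nra.
    apply Rabs_le. unfold K. split; nra.
  - apply Rle_trans with (/ ((2 * s + D0) / s ^ 2)).
    + apply Rinv_le_contravar; [exact Hfr|unfold K; lra].
    + apply (Rmult_le_reg_r (2 * s + D0)); [lra|].
      replace (/ ((2 * s + D0) / s ^ 2) * (2 * s + D0)) with (s ^ 2) by (field; lra). lra.
Qed.

End Lyapunov.

(** * The solution phi in the rescaled variable *)

Lemma Rabs_Re_div_Cmod (z : C) : 0 < Cmod z -> -1 <= Re z / Cmod z <= 1.
Proof.
  intros Hz. pose proof (Rle_trans _ _ _ (Rmax_l _ _) (Rmax_Cmod z)) as H.
  apply Rabs_le_between in H. fold (Re z) in H.
  split; apply (Rmult_le_reg_r (Cmod z)); try exact Hz;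
    unfold Rdiv; rewrite Rmult_assoc, Rinv_l by lra; lra.
Qed.

Lemma polar_form (z : C) : 0 < Cmod z -> 0 < Carg z ->
  z = (Cmod z * cos (Carg z), Cmod z * sin (Carg z)).
Proof.
  intros Hz Harg. pose proof (Rabs_Re_div_Cmod z Hz) as Hb.
  assert (Hsq : Re z ^ 2 + Im z ^ 2 = Cmod z ^ 2).
  { unfold Cmod. rewrite pow2_sqrt; [reflexivity|]. nra. }
  unfold Carg in *. destruct (Rle_dec 0 (Im z)) as [HIm|HIm].
  - rewrite cos_acos, sin_acos by assumption.
    replace (1 - (Re z / Cmod z)²) with ((Im z / Cmod z) ^ 2).
    2: { unfold Rsqr. replace (Im z ^ 2) with (Cmod z ^ 2 - Re z ^ 2) by lra.
         apply (Rmult_eq_reg_r (Cmod z ^ 2)); [|nra]. field_simplify; [|lra|lra]. lra. }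
    rewrite sqrt_pow2 by (now apply Rdiv_le_0_compat).
    apply injective_projections; simpl; unfold Re, Im; field; lra.
  - exfalso. pose proof (acos_bound (Re z / Cmod z)). lra.
Qed.

Lemma Carg_scale (z : C) (r : R) : 0 < Cmod z -> 0 < r -> Carg (z * RtoC r)%C = Carg z.
Proof.
  intros Hz Hr. unfold Carg. rewrite (Cmod_mult_pos z r Hr).
  replace (Re (z * RtoC r)%C) with (Re z * r) by (unfold Re, Im; simpl; ring).
  replace (Im (z * RtoC r)%C) with (Im z * r) by (unfold Re, Im; simpl; ring).
  replace (Re z * r / (Cmod z * r)) with (Re z / Cmod z) by (field; lra).
  destruct (Rle_dec 0 (Im z)), (Rle_dec 0 (Im z * r)); try reflexivity; exfalso; nra.
Qed.

Section Solution.
Variable w : C.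

(** Real and imaginary part of [sqrt x * ((ln x - i) P (x^2) - Q (x^2))].  Apart from a
    power of [|zeta|], this is [phi] in the variable [x = |zeta| u]: the constants in the
    definition of [phi] cancel Euler's constant, [ln 2] and the argument of [zeta] in the
    logarithm of [K_0]. *)
Definition psi1 := frobenius (I0_re w) (fun s => I0_im w s - H_re w s).
Definition psi2 := frobenius (I0_im w) (fun s => - I0_re w s - H_im w s).

Let dI_re := PSeries (PS_derive (fun n => Re (I0_coef w n))).
Let dI_im := PSeries (PS_derive (fun n => Im (I0_coef w n))).
Let dH_re := PSeries (PS_derive (fun n => harmonic n * Re (I0_coef w n))).
Let dH_im := PSeries (PS_derive (fun n => harmonic n * Im (I0_coef w n))).

Definition dpsi1 := dfrobenius (I0_re w)
    (fun s => I0_im w s - H_re w s) dI_re (fun s => dI_im s - dH_re s).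
Definition dpsi2 := dfrobenius (I0_im w)
    (fun s => - I0_re w s - H_im w s) dI_im (fun s => - dI_re s - dH_im s).

Let Hre := CV_radius_I0_coef_Re w.
Let Him := CV_radius_I0_coef_Im w.
Let HHre := CV_radius_harmonic_I0_coef_Re w.
Let HHim := CV_radius_harmonic_I0_coef_Im w.

Lemma is_derive_I0_re s : is_derive (I0_re w) s (dI_re s).
Proof. exact (is_derive_PSeries_entire _ s Hre). Qed.

Lemma is_derive_I0_im s : is_derive (I0_im w) s (dI_im s).
Proof. exact (is_derive_PSeries_entire _ s Him). Qed.

Lemma is_derive_H_re s : is_derive (H_re w) s (dH_re s).
Proof. exact (is_derive_PSeries_entire _ s HHre). Qed.

Lemma is_derive_H_im s : is_derive (H_im w) s (dH_im s).
Proof. exact (is_derive_PSeries_entire _ s HHim). Qed.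

Lemma is_derive_psi1_regular_part s : is_derive (fun s => I0_im w s - H_re w s) s (dI_im s - dH_re s).
Proof.
  exact (is_derive_minus (I0_im w) (H_re w) s _ _ (is_derive_I0_im s) (is_derive_H_re s)).
Qed.

Lemma is_derive_psi2_regular_part s : is_derive (fun s => - I0_re w s - H_im w s) s (- dI_re s - dH_im s).
Proof.
  exact (is_derive_minus (fun s => - I0_re w s) (H_im w) s _ _
    (is_derive_opp (I0_re w) s _ (is_derive_I0_re s)) (is_derive_H_im s)).
Qed.

Lemma is_derive_psi1 x : 0 < x -> is_derive psi1 x (dpsi1 x).
Proof. intros Hx. exact (is_derive_frobenius _ _ _ _ x Hx is_derive_I0_re is_derive_psi1_regular_part). Qed.

Lemma is_derive_psi2 x : 0 < x -> is_derive psi2 x (dpsi2 x).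
Proof. intros Hx. exact (is_derive_frobenius _ _ _ _ x Hx is_derive_I0_im is_derive_psi2_regular_part). Qed.

Let dd a := PSeries (PS_derive (PS_derive a)).

Lemma is_derive_PSeries_derive a s : CV_radius a = p_infty -> is_derive (PSeries (PS_derive a)) s (dd a s).
Proof. intros H. apply is_derive_PSeries_entire. now rewrite CV_radius_derive. Qed.

Lemma is_derive_dpsi1 x : 0 < x ->
  is_derive dpsi1 x (- (1 / (4 * x ^ 2)) * psi1 x + (4 * Re w * psi1 x - 4 * Im w * psi2 x)).
Proof.
  intros Hx.
  pose proof (is_derive_dfrobenius (I0_re w)
    (fun s => I0_im w s - H_re w s) dI_re (fun s => dI_im s - dH_re s)
    (dd (fun n => Re (I0_coef w n)))
    (fun s => dd (fun n => Im (I0_coef w n)) s - dd (fun n => harmonic n * Re (I0_coef w n)) s) x Hx) as H.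
  fold psi1 dpsi1 in H.
  replace (4 * Re w * psi1 x - 4 * Im w * psi2 x) with (4 * frobenius
     (fun s => s * dd (fun n => Re (I0_coef w n)) s + dI_re s)
     (fun s => s * (dd (fun n => Im (I0_coef w n)) s - dd (fun n => harmonic n * Re (I0_coef w n)) s)
        + (dI_im s - dH_re s) + dI_re s) x).
  { apply H; intros s.
    - exact (is_derive_I0_re s).
    - exact (is_derive_psi1_regular_part s).
    - exact (is_derive_PSeries_derive _ s Hre).
    - exact (is_derive_minus dI_im dH_re s _ _ (is_derive_PSeries_derive _ s Him) (is_derive_PSeries_derive _ s HHre)). }
  clear H. unfold psi1, psi2, frobenius.
  pose proof (I0_re_equation w (x ^ 2)) as G1. pose proof (I0_im_equation w (x ^ 2)) as G2.
  pose proof (H_re_equation w (x ^ 2)) as G3.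
  fold (dd (fun n => Re (I0_coef w n))) dI_re in G1.
  fold (dd (fun n => Im (I0_coef w n))) dI_im in G2.
  fold (dd (fun n => harmonic n * Re (I0_coef w n))) dH_re dI_re in G3.
  rewrite G1.
  match goal with |- context [?a + dI_re (x ^ 2)] =>
    replace (a + dI_re (x ^ 2)) with
    (Im w * I0_re w (x ^ 2) + Re w * I0_im w (x ^ 2) - (Re w * H_re w (x ^ 2) + - Im w * H_im w (x ^ 2)))
  end; [ring|lra].
Qed.

Lemma is_derive_dpsi2 x : 0 < x ->
  is_derive dpsi2 x (- (1 / (4 * x ^ 2)) * psi2 x + (4 * Im w * psi1 x + 4 * Re w * psi2 x)).
Proof.
  intros Hx.
  pose proof (is_derive_dfrobenius (I0_im w)
    (fun s => - I0_re w s - H_im w s) dI_im (fun s => - dI_re s - dH_im s)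
    (dd (fun n => Im (I0_coef w n)))
    (fun s => - dd (fun n => Re (I0_coef w n)) s - dd (fun n => harmonic n * Im (I0_coef w n)) s) x Hx) as H.
  fold psi2 dpsi2 in H.
  replace (4 * Im w * psi1 x + 4 * Re w * psi2 x) with (4 * frobenius
     (fun s => s * dd (fun n => Im (I0_coef w n)) s + dI_im s)
     (fun s => s * (- dd (fun n => Re (I0_coef w n)) s - dd (fun n => harmonic n * Im (I0_coef w n)) s)
        + (- dI_re s - dH_im s) + dI_im s) x).
  { apply H; intros s.
    - exact (is_derive_I0_im s).
    - exact (is_derive_psi2_regular_part s).
    - exact (is_derive_PSeries_derive _ s Him).
    - exact (is_derive_minus (fun s => - dI_re s) dH_im s _ _
        (is_derive_opp dI_re s _ (is_derive_PSeries_derive _ s Hre)) (is_derive_PSeries_derive _ s HHim)). }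
  clear H. unfold psi1, psi2, frobenius.
  pose proof (I0_re_equation w (x ^ 2)) as G1. pose proof (I0_im_equation w (x ^ 2)) as G2.
  pose proof (H_im_equation w (x ^ 2)) as G3.
  fold (dd (fun n => Re (I0_coef w n))) dI_re in G1.
  fold (dd (fun n => Im (I0_coef w n))) dI_im in G2.
  fold (dd (fun n => harmonic n * Im (I0_coef w n))) dH_im dI_im in G3.
  rewrite G2.
  match goal with |- context [?a + (?b) + dI_im (x ^ 2)] =>
    replace (a + b + dI_im (x ^ 2)) with
    (- (Re w * I0_re w (x ^ 2) - Im w * I0_im w (x ^ 2)) - (Im w * H_re w (x ^ 2) + Re w * H_im w (x ^ 2)))
  end; [ring|lra].
Qed.

(** The limit of the Wronskian at the origin is 1, because [P 0 = 1] and [Q 0 = 0]. *)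
Lemma psi_wronskian_pos_near_0 x0 : 0 < x0 ->
  exists x, 0 < x < x0 /\ 0 < psi1 x * dpsi2 x - psi2 x * dpsi1 x.
Proof.
  intros Hx0.
  apply frobenius_wronskian_pos; try exact Hx0; try (intros s).
  - exact (continuity_pt_of_derive _ _ _ (is_derive_I0_re s)).
  - exact (continuity_pt_of_derive _ _ _ (is_derive_psi1_regular_part s)).
  - exact (continuity_pt_of_derive _ _ _ (is_derive_PSeries_derive _ s Hre)).
  - exact (continuity_pt_minus _ _ _
      (continuity_pt_of_derive _ _ _ (is_derive_PSeries_derive _ s Him))
      (continuity_pt_of_derive _ _ _ (is_derive_PSeries_derive _ s HHre))).
  - exact (continuity_pt_of_derive _ _ _ (is_derive_I0_im s)).
  - exact (continuity_pt_of_derive _ _ _ (is_derive_psi2_regular_part s)).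
  - exact (continuity_pt_of_derive _ _ _ (is_derive_PSeries_derive _ s Him)).
  - exact (continuity_pt_minus _ _ _
      (continuity_pt_opp _ _ (continuity_pt_of_derive _ _ _ (is_derive_PSeries_derive _ s Hre)))
      (continuity_pt_of_derive _ _ _ (is_derive_PSeries_derive _ s HHim))).
  - unfold I0_re, I0_im, H_re, H_im. rewrite !PSeries_0, harmonic_0.
    unfold I0_coef. simpl. unfold Re, Im. simpl. field_simplify; lra.
Qed.

End Solution.

Lemma phi_scaling (zeta : C) (u : R) (rho := Cmod zeta) (th := Carg zeta)
  (w := ((cos th ^ 2 - sin th ^ 2) / 4, 2 * cos th * sin th / 4) : C) :
  0 < rho -> 0 < th -> 0 < u ->
  phi zeta u = (/ sqrt rho * psi1 w (rho * u), / sqrt rho * psi2 w (rho * u)).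
Proof.
  intros Hr Hth Hu.
  pose proof (polar_form zeta Hr Hth) as Hz. fold rho th in Hz.
  assert (Hw : ((zeta * u) ^ 2 / 4)%C = (w * RtoC ((rho * u) ^ 2))%C).
  { rewrite Hz. unfold w. apply injective_projections; simpl; field. }
  unfold phi. rewrite (Bessel_K0_series w _ _ Hw), (Bessel_I0_series w _ _ Hw).
  assert (Hlog : Clog (zeta * u / 2)%C = (ln (rho * u) - ln 2, th)).
  { replace (zeta * u / 2)%C with (zeta * RtoC (u / 2))%C.
    2: { apply injective_projections; simpl; field. }
    unfold Clog. rewrite Carg_scale, Cmod_mult_pos by (assumption || lra).
    fold rho th. f_equal. rewrite <- ln_div by nra. f_equal. field. }
  rewrite Hlog. unfold psi1, psi2, frobenius. fold th.
  rewrite (sqrt_mult rho u) by lra.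
  assert (Hs : 0 < sqrt rho) by now apply sqrt_lt_R0.
  set (l := ln (rho * u)). set (s := (rho * u) ^ 2).
  apply injective_projections; simpl; field; lra.
Qed.

Lemma log_deriv_phi (zeta : C) (u : R) (rho := Cmod zeta) (th := Carg zeta)
  (w := ((cos th ^ 2 - sin th ^ 2) / 4, 2 * cos th * sin th / 4) : C) (x := rho * u) :
  0 < rho -> 0 < th -> 0 < u -> 0 < psi1 w x ^ 2 + psi2 w x ^ 2 ->
  log_deriv (phi zeta) u =
    (rho * ((dpsi1 w x * psi1 w x + dpsi2 w x * psi2 w x) / (psi1 w x ^ 2 + psi2 w x ^ 2)),
     rho * ((dpsi2 w x * psi1 w x - dpsi1 w x * psi2 w x) / (psi1 w x ^ 2 + psi2 w x ^ 2))).
Proof.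
  intros Hr Hth Hu HN.
  assert (Hx : 0 < x) by now apply Rmult_lt_0_compat.
  assert (Hs : 0 < sqrt rho) by now apply sqrt_lt_R0.
  assert (Hsc : forall f df, is_derive f x df ->
    is_derive (fun t => / sqrt rho * f (rho * t)) u (/ sqrt rho * (rho * df))).
  { intros f df Hf. apply (is_derive_scal (fun t => f (rho * t))).
    apply (is_derive_comp f (fun t => rho * t) u df rho); [exact Hf|].
    auto_derive; [trivial|ring]. }
  assert (HD : is_CDerive (phi zeta) u
    (/ sqrt rho * (rho * dpsi1 w x), / sqrt rho * (rho * dpsi2 w x))).
  { apply (is_derive_ext_loc (V := C_R_NormedModule)
      (fun t => (/ sqrt rho * psi1 w (rho * t), / sqrt rho * psi2 w (rho * t)))).
    - apply (locally_interval _ u 0 p_infty); simpl; [exact Hu|exact I|].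
      intros t Ht _. symmetry. now apply phi_scaling.
    - apply is_CDerive_pair; simpl; apply Hsc; [now apply is_derive_psi1|now apply is_derive_psi2]. }
  unfold log_deriv. rewrite (is_CDerive_CDerive _ _ _ HD), (phi_scaling zeta u Hr Hth Hu).
  fold rho th w x.
  set (p := psi1 w x) in *. set (q := psi2 w x) in *.
  assert (Hi : 0 < / sqrt rho) by now apply Rinv_0_lt_compat.
  set (i := / sqrt rho) in *.
  assert (HN2 : 0 < (i * p) ^ 2 + (i * q) ^ 2).
  { replace ((i * p) ^ 2 + (i * q) ^ 2) with (i ^ 2 * (p ^ 2 + q ^ 2)) by ring.
    apply Rmult_lt_0_compat; [|exact HN]. nra. }
  apply injective_projections; simpl; field; simpl in *; repeat split; try lra; nra.
Qed.

Lemma Im_sqr_polar (zeta : C) : 0 < Cmod zeta -> 0 < Carg zeta <= PI / 2 ->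
  Im (zeta ^ 2)%C = 2 * Cmod zeta ^ 2 * (cos (Carg zeta) * sin (Carg zeta)).
Proof.
  intros Hr Hth. pose proof (polar_form zeta Hr (proj1 Hth)) as Hz.
  rewrite Hz at 1. unfold Im. simpl. ring.
Qed.

(** * The proposition *)

Theorem proposition7p1 :
  (forall zeta : C,
     zeta <> RtoC 0 -> 0 < Carg zeta <= PI / 2 ->
     let J := fun u : R => 0 < u <= 1 / (2 * Cmod zeta) in
     SL_solution Vt J (phit zeta) /\
     (forall u : R, J u -> phit zeta u <> RtoC 0) /\
     (forall u : R, J u -> U (V zeta) (phit zeta) u < 0) /\
     (forall u : R, J u ->
        ex_RInt_gen (E (V zeta) Vt (phit zeta)) (at_right 0) (at_point u)) /\
     circles_invariant (V zeta) J
       (center (V zeta) Vt (phit zeta)) (Rad (V zeta) Vt (phit zeta))) /\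
  (exists M : R, forall zeta : C,
     zeta <> RtoC 0 -> 0 < Carg zeta <= PI / 2 ->
     forall u : R, 0 < u <= 1 / (2 * Cmod zeta) ->
     T (V zeta) Vt (phit zeta) u <= M) /\
  (forall theta : R,
     0 < theta <= PI / 2 ->
     exists K : R, 0 < K /\
     forall zeta : C,
       zeta <> RtoC 0 -> Carg zeta = theta -> 0 < Im (zeta ^ 2)%C ->
       forall u : R, 1 / (2 * Cmod zeta) < u ->
         let y := log_deriv (phi zeta) u in
         Rabs (Re y) <= K * Cmod zeta /\ Cmod zeta / K <= Im y).
Proof.
  pose proof PI_RGT_0 as HPI.
  split; [|split].
  - intros zeta Hz Hth J.
    assert (Hr : 0 < Cmod zeta) by now apply Cmod_gt_0.
    assert (HJ : forall u, J u -> 0 < u < 2 / (3 * Cmod zeta)).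
    { intros u [H1 H2]. split; [exact H1|]. apply Rle_lt_trans with (1 := H2).
      apply (Rmult_lt_reg_r (6 * Cmod zeta)); [lra|]. field_simplify; lra. }
    split; [|split; [|split; [|split]]].
    + intros u [Hu _].
      pose proof (is_CDerive_phit zeta u Hr Hu) as Hd.
      rewrite (is_CDerive_CDerive _ _ _ Hd).
      split; [exact Hd|]. now apply is_CDerive_CDerive_phit.
    + intros u [Hu _]. now apply phit_neq_0.
    + intros u Hu. apply HJ in Hu. apply U_phit_neg; [exact Hr|lra].
    + intros u Hu. eexists. apply is_RInt_gen_E_phit; [exact Hr|now apply HJ].
    + apply circles_invariant_phit; [exact Hr|].
      rewrite Im_sqr_polar by assumption.
      assert (0 <= cos (Carg zeta)) by (apply cos_ge_0; lra).
      assert (0 <= sin (Carg zeta)) by (apply sin_ge_0; lra).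
      apply Rmult_le_pos; [nra|]. now apply Rmult_le_pos.
  - exists (exp 1260). intros zeta Hz _ u Hu.
    apply T_phit_le; [now apply Cmod_gt_0|exact Hu].
  - intros theta Hth.
    assert (Hs : 0 < sin theta) by (apply sin_gt_0; lra).
    destruct (Req_dec theta (PI / 2)) as [->|Hne].
    (* For a right angle [zeta^2] is real, contrary to [Im zeta^2 > 0]. *)
    { exists 1. split; [lra|]. intros zeta Hz Harg HIm.
      rewrite Im_sqr_polar in HIm by (now apply Cmod_gt_0 || (rewrite Harg; lra)).
      rewrite Harg, cos_PI2 in HIm. lra. }
    assert (Hc : 0 < cos theta) by (apply cos_gt_0; lra).
    set (w := ((cos theta ^ 2 - sin theta ^ 2) / 4, 2 * cos theta * sin theta / 4) : C).
    destruct (log_derivative_bounds (cos theta) (sin theta) (psi1 w) (psi2 w) (dpsi1 w) (dpsi2 w))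
      as [K [HK Hbd]]; try assumption.
    + pose proof (sin2_cos2 theta). unfold Rsqr in *. lra.
    + apply is_derive_psi1.
    + apply is_derive_psi2.
    + intros x Hx.
      replace (cos theta ^ 2 - sin theta ^ 2) with (4 * Re w) by (unfold w, Re; simpl; field).
      replace (2 * cos theta * sin theta) with (4 * Im w) by (unfold w, Im; simpl; field).
      now apply is_derive_dpsi1.
    + intros x Hx.
      replace (cos theta ^ 2 - sin theta ^ 2) with (4 * Re w) by (unfold w, Re; simpl; field).
      replace (2 * cos theta * sin theta) with (4 * Im w) by (unfold w, Im; simpl; field).
      now apply is_derive_dpsi2.
    + apply psi_wronskian_pos_near_0.
    + exists K. split; [exact HK|]. intros zeta Hz Harg HIm u Hu y.
      assert (Hr : 0 < Cmod zeta) by now apply Cmod_gt_0.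
      assert (Hx : 1 / 2 < Cmod zeta * u).
      { replace (1 / 2) with (Cmod zeta * (1 / (2 * Cmod zeta))) by (field; lra).
        now apply Rmult_lt_compat_l. }
      assert (Hu0 : 0 < u).
      { apply Rlt_trans with (2 := Hu). apply Rdiv_lt_0_compat; lra. }
      destruct (Hbd _ Hx) as [HN [HRe HIm2]].
      pose proof (log_deriv_phi zeta u Hr) as Hy. rewrite Harg in Hy. fold w in Hy.
      specialize (Hy (proj1 Hth) Hu0 HN). unfold y. rewrite Hy.
      unfold Re, Im, fst, snd. split.
      * rewrite Rabs_mult, (Rabs_pos_eq (Cmod zeta)), Rmult_comm by lra.
        apply Rmult_le_compat_r; [lra|exact HRe].
      * apply Rmult_le_compat_l; [lra|exact HIm2].
Qed.
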